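(* Let $p>0$, $0<s\le1$ and $\omega\in RV(s)$, and suppose that there is a neighbourhood $W$ of $x_0$ such that $\mu(x)=\nu(|x-x_0|)$ for all $x\in W$, where $\nu\in\Gamma V(\rho)$. Let $h_n$ be the smallest solution to $$\omega(h)=\frac{\sigma}{\sqrt{2n\int_0^h\nu(t)\,dt}},$$ put $r_n=\omega(h_n)$, let $\alpha_n=O(r_n^{-\gamma})$ for some $\gamma>0$, and let $\Sigma=\Sigma_{h_n,\alpha_n}(x_0,\omega)$. Then $$\mathcal R_n(\Sigma,\mu)\asymp\ell_{\omega,\nu}(n^{-1})\qquad\text{as }n\to+\infty,$$ where $\ell_{\omega,\nu}$ is slowly varying. Moreover, the minimax rate is equal to $\omega(h_n)$.
   Context: Model: one observes $n$ i.i.d. pairs $(X_i,Y_i)\in\mathbb R\times\mathbb R$ with $Y_i=f(X_i)+\xi_i$, where $f$ is the unknown regression function, the $\xi_i$ are centered Gaussian with variance $\sigma^2$, independent of $X_1,\dots,X_n$, and the $X_i$ have density $\mu$. The function $f$ is to be estimated at a fixed point $x_0$. $\mathbb P^n_{f,\mu}$ is the joint law of $(X_i,Y_i)_{i\le n}$ and $\mathbb E^n_{f,\mu}$ its expectation. Minimax risk: $\mathcal R_n(\Sigma,\mu)=\bigl(\inf_{T_n}\sup_{f\in\Sigma}\mathbb E^n_{f,\mu}\{|T_n(x_0)-f(x_0)|^p\}\bigr)^{1/p}$, the infimum being over all estimators $T_n$ based on the observations. The symbol $\asymp$ stands for equality in order, up to constants depending on $s$ and $p$ but not on $\sigma$;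 saying that the minimax rate is $\omega(h_n)$ means that $\mathcal R_n(\Sigma,\mu)$ is of order $\omega(h_n)$ in this sense. Regular variation: with $\mathbb R^+$ the positive half-line, a continuous function $g:\mathbb R^+\to\mathbb R^+$ is in $RV(b)$, $b\in\mathbb R$, if $\lim_{h\to0^+}g(yh)/g(h)=y^{b}$ for all $y>0$. Functions in $RV(0)$ are called slowly varying. $\Gamma$-variation: a non-decreasing continuous function $\nu:\mathbb R^+\to\mathbb R^+$ is in $\Gamma V(\rho)$, where $\rho:\mathbb R^+\to\mathbb R^+$ is continuous, if $\lim_{h\to0^+}\nu(h+y\rho(h))/\nu(h)=\exp(y)$ for all $y\in\mathbb R$; $\rho$ is called the auxiliary function of $\nu$. Function class: for $\delta>0$ and $\omega\in RV(s)$ with $s>0$, let $k$ be the largest integer (strictly) smaller than $s$ (so $k=0$ when $0<s\le1$) and $\mathcal P_k$ the set of real polynomials of degree $k$ (at most). $\mathcal F_\delta(x_0,\omega)$ is the class of functions $f:[0,1]\to\mathbb R$ such that $\inf_{P\in\mathcal P_k}\sup_{|x-x_0|\le h}|f(x)-P(x-x_0)|\le\omega(h)$ for all $h\le\delta$. For $\alpha>0$, $\mathcal U(\alpha)=\{f:[0,1]\to\mathbb R:\ \|f\|_\infty\le\alpha\}$, and $\Sigma_{\delta,\alpha}(x_0,\omega)=\mathcal F_\delta(x_0,\omega)\cap\mathcal U(\alpha)$.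
   Formalization: The formal theorem adds r_n ≤ α_n for large n: with only α_n = O(r_n^{-γ}) the claim fails, e.g. α_n = e^{-n} forces the minimax risk to be at most e^{-n}, far below ω(h_n). Constant or growing α_n remain covered. *)

(* Defs.v *)
(* MathComp / MathComp-Analysis *)
From HB Require Import structures.
From mathcomp Require Import all_boot all_order all_algebra.
From mathcomp Require Import all_classical all_reals all_analysis.

Set Implicit Arguments.
Unset Strict Implicit.
Unset Printing Implicit Defensive.

Import Order.TTheory GRing.Theory Num.Theory.
Import numFieldNormedType.Exports.

Local Open Scope classical_set_scope.
Local Open Scope ring_scope.

(* Functions on the open half-line ]0, +oo[ are total functions R -> R of which
   only the restriction to ]0, +oo[ is ever constrained or used. *)
Section variation.
Context {R : realType}.
Implicit Types g nu rho : R -> R.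

Definition pos_continuous g :=
  forall h : R, 0 < h -> 0 < g h /\ {for h, continuous g}.

(* Regular variation at 0, of index b *)
Definition RV (b : R) g :=
  pos_continuous g /\
  forall y : R, 0 < y -> g (y * h) / g h @[h --> 0^'+] --> y `^ b.

Definition slowly_varying g := RV 0 g.

(* Gamma-variation at 0 with auxiliary function rho. For y < 0 the limit is
   meaningful only if h + y * rho h lies in the domain ]0, +oo[ of nu for all
   small h, which is therefore part of the definition. *)
Definition GammaV rho nu :=
  [/\ pos_continuous rho,
      pos_continuous nu,
      forall a b : R, 0 < a -> a <= b -> nu a <= nu b &
      forall y : R, (\forall h \near 0^'+, 0 < h + y * rho h) /\
        nu (h + y * rho h) / nu h @[h --> 0^'+] --> expR y].

End variation.

Section function_classes.
Context {R : realType}.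
Implicit Types (f omega : R -> R) (s delta alpha h : R).

(* The largest integer strictly smaller than s, for s > 0 *)
Definition lower_degree s : nat := (absz (Num.ceil s)).-1.

(* Functions [0, 1] -> R are represented by total functions of which only the
   restriction to [0, 1] matters. *)
Definition poly_dev f (x0 : R) h (P : {poly R}) : \bar R :=
  ereal_sup [set (`|f x - P.[x - x0]|)%:E |
             x in [set x : R | 0 <= x <= 1 /\ `|x - x0| <= h]].

(* The parameter s is the index of omega; polynomials have size = degree + 1 *)
Definition F_class s delta (x0 : R) omega : set (R -> R) :=
  [set f | forall h, 0 < h -> h <= delta ->
    (ereal_inf [set poly_dev f x0 h P |
       P in [set P : {poly R} | (size P <= (lower_degree s).+1)%N]]
     <= (omega h)%:E)%E].

Definition U_class alpha : set (R -> R) :=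
  [set f | forall x : R, 0 <= x <= 1 -> `|f x| <= alpha].

Definition Sigma_class s delta alpha (x0 : R) omega : set (R -> R) :=
  F_class s delta x0 omega `&` U_class alpha.

End function_classes.

(* The law P^{(x) n} of n independent variables of law P *)
Section iid.
Context d (T : measurableType d) (R : realType) (P : probability T R).

Definition tuple_cons n (z : T * n.-tuple T) : n.+1.-tuple T :=
  [tuple of z.1 :: z.2].

Lemma measurable_tuple_cons n : measurable_fun [set: _] (@tuple_cons n).
Proof. exact: measurable_cons. Qed.

HB.instance Definition _ n :=
  isMeasurableFun.Build _ _ _ _ (@tuple_cons n) (@measurable_tuple_cons n).

Fixpoint iid_law n : probability (n.-tuple T) R :=
  match n with
  | 0%N => dirac ([tuple] : 0.-tuple T)
  | m.+1 => distribution (P \x iid_law m)%E (@tuple_cons m)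
  end.

End iid.

Section model.
Context {R : realType}.
(* As in the library, measures on the line live on the alias measurableTypeR R
   and measurable functions take values in R; both carry the Borel sets. *)
Local Notation mR := (measurableTypeR R).
Implicit Types (PX : probability mR R) (f : {mfun mR >-> R}).

Definition has_density PX (mu : mR -> R) :=
  [/\ measurable_fun [set: mR] mu, forall x, 0 <= mu x &
      forall A : set mR, measurable A ->
        PX A = (\int[lebesgue_measure]_(x in A) (mu x)%:E)%E].

Definition observe f (z : mR * mR) : R * R := (z.1, f z.1 + z.2).

Lemma measurable_observe f : measurable_fun [set: _] (observe f).
Proof.
apply/measurable_fun_pairP; split => /=; first exact: measurable_fst.
apply: measurable_realfun.measurable_funD; last exact: measurable_snd.
exact: (measurableT_comp (measurable_funPT f)) measurable_fst.
Qed.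

HB.instance Definition _ f :=
  isMeasurableFun.Build _ _ _ _ (observe f) (measurable_observe f).

(* Law of (X, f(X) + xi) with X of law PX and xi ~ N(0, sigma^2) independent *)
Definition pair_law PX (sigma : R) f : probability (R * R)%type R :=
  distribution (PX \x normal_prob 0 sigma)%E (observe f).

Definition joint_law PX sigma f n : probability (n.-tuple (R * R)) R :=
  iid_law (pair_law PX sigma f) n.

(* An estimator of f(x0) is a measurable real function of the n pairs; it may
   depend on n, x0 and on the parameters of the model but not on f. *)
Definition pointwise_risk PX (sigma p x0 : R) n f
    (T : {mfun n.-tuple (R * R) >-> R}) : \bar R :=
  (\int[joint_law PX sigma f n]_z (`|T z - f x0| `^ p)%:E)%E.

Definition minimax_risk PX (sigma p x0 : R) n (Sigma : set (R -> R)) : \bar R :=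
  poweR
    (ereal_inf
      [set ereal_sup [set pointwise_risk PX sigma p x0 f T |
                      f in [set f : {mfun mR >-> R} | Sigma f]] |
       T in [set: {mfun n.-tuple (R * R) >-> R}]])
    p^-1.

Definition bandwidth_eq (omega nu : R -> R) (sigma : R) (n : nat) (h : R) :=
  omega h = sigma /
    Num.sqrt (2 * n%:R * \int[lebesgue_measure]_(t in `]0, h]) nu t).

Definition smallest_bandwidth (omega nu : R -> R) (sigma : R) n (h : R) :=
  [/\ 0 < h, bandwidth_eq omega nu sigma n h &
      forall h', 0 < h' -> bandwidth_eq omega nu sigma n h' -> h <= h'].

Definition same_order (c C : R) (u : nat -> \bar R) (v : nat -> R) :=
  \forall n \near \oo, ((c * v n)%:E <= u n)%E /\ (u n <= (C * v n)%:E)%E.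

End model.

(* Main.v *)
From HB Require Import structures.
Require Import Defs.
From mathcomp Require Import all_boot all_order all_algebra.
From mathcomp Require Import all_classical all_reals all_analysis.
From mathcomp Require Import measurable_realfun ring lra.
Import Order.TTheory GRing.Theory Num.Theory.
Import numFieldNormedType.Exports.
Local Open Scope classical_set_scope.
Local Open Scope ring_scope.

Set Implicit Arguments.
Unset Strict Implicit.

(* Write F h for the integral of nu over ]0, h] and G h = 2 omega(h)^2 F(h), so
   that the bandwidth equation reads G h = sigma^2 / n.

   Rate. Gamma-variation makes F, hence G, rapidly varying: for every lambda > 1
   the ratio G(lambda h) / G(h) tends to infinity. Two bandwidths at which G
   takes comparable values are therefore equivalent, and by the uniform
   convergence theorem so are the values of omega there. Composing omega with a
   continuous approximate inverse H of G gives a slowly varying omega o H with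
   omega (h_n) ~ omega (H (1 / n)) for every sigma.

   Lower bound. Since only h <= h_n is constrained, the class contains 0 and the
   function equal to r_n on the window |x - x0| <= h_n and to 0 elsewhere. The
   likelihood ratio L of the two laws satisfies
   E_0 L^2 = (1 + q (exp (r_n^2 / sigma^2) - 1))^n with n q r_n^2 = sigma^2,
   q being the probability of the window, so it is bounded in n and Le Cam's
   two-point argument applies.

   Upper bound. The average of the Y_i with X_i in the window has bias of order
   r_n, noise of order sigma / sqrt (n q) = r_n (controlled through its moment
   generating function, for all p at once), and fails only if the window has
   fewer than n q / 2 points. The probability of that is exponentially small in
   n q = sigma^2 / r_n^2, which beats alpha_n = O(r_n^(-gamma)). *)

(** * Regular and rapid variation *)

Section regular_variation.
Context {R : realType}.
Implicit Types (g : R -> R) (s : R).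

Lemma near0rP (P : R -> Prop) :
  (\forall h \near 0^'+, P h) <->
  exists2 d : R, 0 < d & forall h, 0 < h -> h < d -> P h.
Proof.
split.
  move=> [d /= d0 dP]; exists d => // h h0 hd; apply: dP => //=.
  by rewrite sub0r normrN gtr0_norm.
move=> [d d0 dP]; exists d => //= h; rewrite /= sub0r normrN => hd h0.
by apply: dP => //; rewrite (le_lt_trans (ler_norm _)).
Qed.

(** Logarithms turn the limit of ratios into a limit of increments, the form in which uniformity is
    proved. *)
Lemma RV_log s g : RV s g -> forall x e : R, 0 < e ->
  exists2 d : R, 0 < d & forall h, 0 < h -> h < d ->
    `|ln (g (expR x * h)) - ln (g h) - s * x| < e.
Proof.
move=> [gpos gRV] x e e0; apply/near0rP.
have := gRV _ (expR_gt0 x); rewrite -expRM mulrC => cv.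
have /cvgrPdist_lt/(_ _ e0) :
    ln (g (expR x * h) / g h) @[h --> 0^'+] --> ln (expR (s * x)).
  exact: (cvg_comp _ _ cv (continuous_ln (expR_gt0 _))).
apply: filterS2 (nbhs_right_gt 0) => h h0.
have gh : 0 < g h by have [] := gpos _ h0.
have gxh : 0 < g (expR x * h) by have [] := gpos _ (mulr_gt0 (expR_gt0 x) h0).
by rewrite expRK ln_div ?posrE// distrC.
Qed.

(* If the sets of exponents at which convergence is not yet uniform below 1/N
   were all dense, Baire would give a point where convergence fails. Hence
   convergence is uniform near some x0, and by rescaling h also near 0. *)
Lemma RV_uniform s g : 0 <= s <= 1 -> RV s g -> forall e : R, 0 < e ->
  exists eta d : R, [/\ 0 < eta, 0 < d & forall h x, 0 < h -> h < d ->
    0 <= x -> x <= eta -> `|ln (g (expR x * h)) - ln (g h)| <= e].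
Proof.
move=> /andP[s0 s1] gRV e e0.
pose k h x := ln (g (expR x * h)) - ln (g h) - s * x.
have [gpos _] := gRV.
pose U (N : nat) := \bigcup_(h in [set h | 0 < h < N.+1%:R^-1])
  ((fun x => `|k h x|) @^-1` [set y | e / 3 < y]).
have e3 : 0 < e / 3 by rewrite divr_gt0.
have Uopen N : open (U N).
  apply: bigcup_open => h /= /andP[h0 _].
  apply: open_comp; last exact: open_gt.
  move=> x _; apply: (@continuous_comp _ _ _ (k h)); last exact: norm_continuous.
  apply: continuousB; last by apply: continuousM; [exact: cvg_cst|exact: cvg_id].
  apply: continuousB; last exact: cvg_cst.
  have xh0 : 0 < expR x * h by rewrite mulr_gt0// expR_gt0.
  apply: (@continuous_comp _ _ _ (fun x => g (expR x * h)) (@ln R)); last first.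
    by apply: continuous_ln; have [] := gpos _ xh0.
  apply: (@continuous_comp _ _ _ (fun x => expR x * h) g); last first.
    by have [] := gpos _ xh0.
  by apply: continuousM; [exact: continuous_expR|exact: cvg_cst].
have [allD|/existsNP[N]] := pselect (forall N, dense (U N)).
  have /(_ setT) := @Baire R R U (fun i => conj (Uopen i) (allD i)).
  move=> /(_ (ex_intro _ 0 I) openT)[x [_ /= Ux]].
  have [d d0 dP] := RV_log gRV x e3.
  have [h /= /andP[h0 hN]] := Ux (Num.bound d^-1) I.
  have hd : h < d.
    apply: (lt_trans hN); rewrite invf_plt ?posrE//.
    rewrite (lt_trans (archi_boundP _)) ?invr_ge0 ?ltW//.
    by rewrite ltr_nat.
  by move=> /lt_trans /(_ (dP _ h0 hd)); rewrite ltxx.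
move=> /existsNP[V /not_implyP[[x0 Vx0] /not_implyP[Vo /set0P/negP/negPn/eqP V0]]].
have /nbhs_ballP[r /= r0 rV] := open_nbhs_nbhs (conj Vo Vx0).
have kV h x : 0 < h -> h < N.+1%:R^-1 -> V x -> `|k h x| <= e / 3.
  move=> h0 hN Vx; rewrite leNgt; apply/negP => ke.
  suff : (V `&` U N) x by rewrite V0.
  by split => //; exists h => //=; rewrite h0.
(* [r / 2] keeps [x0 + x] in [V], and [e / 3] bounds [s * x] because [s] is at most 1; with the
   deviations at [x0 + x] and [x0] the total is [e]. *)
exists (Num.min (r / 2) (e / 3)), (expR x0 * N.+1%:R^-1).
split; first by rewrite lt_min e3 andbT divr_gt0.
  by rewrite mulr_gt0 ?expR_gt0 ?invr_gt0.
move=> h x h0 hd x_ge0; rewrite le_min => /andP[xr xe].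
(* Over the base point [h1] the exponents [x0 + x] and [x0] lead to [expR x * h] and [h];
   subtracting the two deviations removes [g h1]. *)
pose h1 := expR (- x0) * h.
have h10 : 0 < h1 by rewrite mulr_gt0 ?expR_gt0.
have h1N : h1 < N.+1%:R^-1.
  by rewrite /h1 expRN -ltr_pdivlMl ?invr_gt0 ?expR_gt0// invrK.
have := kV _ _ h10 h1N Vx0.
have /(kV _ _ h10 h1N) : V (x0 + x).
  apply: rV; rewrite /ball /= opprD addrA subrr sub0r normrN ger0_norm//.
  by rewrite (le_lt_trans xr)// ltr_pdivrMr// ltr_pMr// ltr1n.
have -> y : k h1 y = ln (g (expR (y - x0) * h)) - ln (g h1) - s * y.
  by rewrite /k /h1 mulrA -expRD.
rewrite /k {1}/h1 mulrA -expRD subrr expR0 mul1r (addrC x0) addrK.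
rewrite !ler_norml => /andP[? ?] /andP[? ?].
have : 0 <= s * x <= e / 3.
  rewrite mulr_ge0//= (le_trans _ xe)// ler_piMl//.
move=> /andP[? ?].
by apply/andP; split; lra.
Qed.

Lemma expR_exp_unbounded (M a : R) : 0 < a -> exists i : nat, M < expR a ^+ i.
Proof.
move=> a0; exists (Num.bound (`|M| / a)); rewrite -expRM_natl.
apply: lt_le_trans (expR_ge1Dx _).
rewrite (le_lt_trans (ler_norm M))// (@lt_trans _ _ (`|M| + 1)) ?ltrDl//.
by rewrite addrC ltrD2l -ltr_pdivrMr// archi_boundP// divr_ge0// ltW.
Qed.

Lemma dyadic_scale (d h : R) : 0 < h -> h <= d ->
  exists i : nat, d / 2 < 2 ^+ i * h <= d.
Proof.
move=> h0 hd.
have ex : exists i : nat, d / 2 < 2 ^+ i * h.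
  exists (Num.bound (d / 2 / h)).
  by rewrite -ltr_pdivrMr// upper_nthrootP.
case: (ex_minnP ex) => -[|i] iP imin.
  by exists 0%N; rewrite iP expr0 mul1r.
exists i.+1; rewrite iP /= exprS -mulrA mulrC -ler_pdivlMr//.
by rewrite leNgt; apply/negP => /imin; rewrite ltnn.
Qed.

(** Near 0, halving [h] multiplies [g] by at most a fixed factor below 1. Every smaller scale
    descends by halvings from [[d / 4, d / 2]], where [g] is bounded by compactness, so [g] decays
    geometrically. *)
Lemma RV_cvg0 s g : 0 < s -> RV s g -> forall e : R, 0 < e ->
  exists2 d : R, 0 < d & forall h, 0 < h -> h < d -> g h < e.
Proof.
move=> s0 gRV e e0; have [gpos _] := gRV.
have [|d d0 dP] := RV_log gRV (- ln 2) (_ : 0 < s * ln 2 / 2).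
  by rewrite divr_gt0// mulr_gt0// ln_gt0// ltr1n.
(* [th] is 2 to the power [- s / 2]: half of the exponent pays for the error in [RV_log]. *)
pose th : R := expR (- (s * ln 2 / 2)).
have th1 : th < 1.
  by rewrite expR_lt1 oppr_lt0 divr_gt0// mulr_gt0// ln_gt0// ltr1n.
have gpos' h : 0 < h -> 0 < g h by move=> /gpos[].
have step h : 0 < h -> h < d -> g (h / 2) <= th * g h.
  move=> h0 hd; have := dP _ h0 hd.
  rewrite expRN lnK ?posrE// mulrC ltr_norml => /andP[_].
  rewrite mulrN opprK => lt1.
  rewrite -ler_ln ?posrE ?mulr_gt0 ?expR_gt0 ?gpos' ?divr_gt0//.
  rewrite lnM ?posrE ?expR_gt0 ?gpos'// expRK.
  move: lt1; set A := s * _; set B := ln _; set C := ln _; lra.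
have iter i h : 0 < h -> 2 ^+ i * h < d -> g h <= th ^+ i * g (2 ^+ i * h).
  elim: i h => [|i IH] h h0 hd; first by rewrite !expr0 !mul1r.
  have h20 : 0 < 2 * h by rewrite mulr_gt0.
  have /IH : 2 ^+ i * (2 * h) < d by rewrite mulrA -exprSr.
  move=> /(_ h20); rewrite mulrA -exprSr => le1.
  have {1}-> : h = 2 * h / 2 by rewrite mulrC mulKf.
  have h2d : 2 * h < d.
    apply: le_lt_trans hd; rewrite exprS -mulrA ler_pM2l//.
    by apply: ler_peMl; rewrite ?exprn_ege1 ?ler1n ?ltW.
  apply: (le_trans (step _ h20 h2d)).
  by rewrite exprS -mulrA ler_wpM2l// expR_ge0.
have [c _ cmax] : exists2 c, c \in `[d / 4, d / 2] & forall t, t \in `[d / 4, d / 2] -> g t <= g c.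
  apply: EVT_max; first by rewrite ler_pM2l// lef_pV2 ?posrE// ler_nat.
  apply: continuous_in_subspaceT => x; rewrite inE /= in_itv /= => /andP[x1 _].
  have [] // := gpos x.
  by rewrite (lt_le_trans _ x1)// divr_gt0.
have d4 : 0 < d / 4 by rewrite divr_gt0.
have d2 : 0 < d / 2 by rewrite divr_gt0.
have bnd i h : 0 < h -> 2 ^+ i * h <= d / 2 -> g h <= th ^+ i * g c.
  move=> h0 hd; have hi0 : 0 < 2 ^+ i * h by rewrite mulr_gt0.
  have [j] := dyadic_scale hi0 hd.
  rewrite mulrA -exprD => /andP[j1 j2].
  have := @iter (j + i)%N h h0; rewrite (le_lt_trans j2); last first.
    by rewrite ltr_pdivrMr// ltr_pMr// ltr1n.
  move=> /(_ isT) /le_trans; apply.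
  rewrite addnC exprD -mulrA ler_wpM2l ?exprn_ge0 ?expR_ge0//.
  rewrite -[leRHS]mul1r; apply: ler_pM.
  - by rewrite exprn_ge0 ?expR_ge0.
  - by rewrite ltW// gpos'// mulr_gt0// exprn_gt0.
  - by rewrite exprn_ile1 ?expR_ge0 ?ltW.
  by apply: cmax; rewrite in_itv /= (addnC i) j2 andbT; move: j1; lra.
have [i ie] : exists i : nat, th ^+ i * g c < e.
  have [i ie] := expR_exp_unbounded (g c / e) (divr_gt0 (mulr_gt0 s0 (ln_gt0 (ltr1n R 2))) (ltr0n R 2)).
  exists i; rewrite /th expRN exprVn mulrC ltr_pdivrMr ?exprn_gt0 ?expR_gt0//.
  by rewrite mulrC -ltr_pdivrMr.
exists (d / 2 / 2 ^+ i); first by rewrite divr_gt0.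
move=> h h0 hd; apply: le_lt_trans ie; apply: bnd => //.
by rewrite mulrC -ler_pdivlMr ?ltW.
Qed.

End regular_variation.

(** * Mass of the design density near the centre *)

Section mass.
Context {R : realType}.
Local Notation leb := (@lebesgue_measure R).

(** F of the overview; for a density symmetric about the centre, half the probability of the
    window. *)
Definition mass (nu : R -> R) (h : R) : R := \int[leb]_(t in `]0, h]) nu t.

Lemma length_lty (a b : R) : (leb (`]a, b] : set R) < +oo)%E.
Proof.
by rewrite lebesgue_measure_itv/=; case: ifP => _; rewrite ?ltry// -EFinB ltry.
Qed.

Lemma fine_length (a b : R) : a <= b -> fine (leb (`]a, b] : set R)) = b - a.
Proof.
move=> ab; rewrite lebesgue_measure_itv/= lte_fin.
by move: ab; rewrite le_eqVlt => /predU1P[->|->]; rewrite ?ltxx ?subrr.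
Qed.

Context (nu : R -> R) (nu_pos : pos_continuous nu)
  (nu_nd : forall a b : R, 0 < a -> a <= b -> nu a <= nu b).

Lemma mass_measurable (a b : R) : 0 <= a -> measurable_fun (`]a, b] : set R) nu.
Proof.
move=> a0; apply: (@measurable_funS _ _ _ _ (`]0, +oo[ : set R)) => //.
  by move=> x /=; rewrite !in_itv/= andbT => /andP[/(le_lt_trans a0)].
apply: open_continuous_measurable_fun; first exact: interval_open.
by move=> x; rewrite inE /= in_itv/= andbT => /nu_pos[].
Qed.

Lemma mass_integrable (a b : R) : 0 <= a ->
  leb.-integrable (`]a, b] : set R) (EFin \o nu).
Proof.
move=> a0; have mab := @mass_measurable a b a0.
apply: measurable_bounded_integrable => //.
  exact: length_lty.
exists (nu b); split; first exact: num_real.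
move=> M bM x /=; rewrite in_itv/= => /andP[ax xb].
have x0 := le_lt_trans a0 ax; have [nux _] := nu_pos x0.
by rewrite ger0_norm ?ltW// (le_lt_trans _ bM)// nu_nd.
Qed.

Lemma mass_increment_le (a b : R) : 0 <= a -> a <= b -> 0 < b ->
  \int[leb]_(t in `]a, b]) nu t <= (b - a) * nu b.
Proof.
move=> a0 ab b0; rewrite mulrC -(fine_length ab) -Rintegral_cst//.
apply: le_Rintegral => //; first exact: mass_integrable.
  apply: measurable_bounded_integrable => //; last first.
    by exists `|nu b|; split => // M bM x _; exact: ltW.
  exact: length_lty.
by move=> x /=; rewrite in_itv/= => /andP[ax xb]; rewrite nu_nd// (le_lt_trans a0).
Qed.

Lemma mass_increment_ge (a b : R) : 0 < a -> a <= b ->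
  (b - a) * nu a <= \int[leb]_(t in `]a, b]) nu t.
Proof.
move=> a0 ab; rewrite mulrC -(fine_length ab) -Rintegral_cst//.
apply: le_Rintegral => //; last 2 first.
- by apply: mass_integrable; exact: ltW.
- by move=> x /=; rewrite in_itv/= => /andP[ax xb]; rewrite nu_nd// ltW.
apply: measurable_bounded_integrable => //; last first.
  by exists `|nu a|; split => // M bM x _; exact: ltW.
exact: length_lty.
Qed.

Lemma massB (a b : R) : 0 < a -> a <= b ->
  mass nu b - mass nu a = \int[leb]_(t in `]a, b]) nu t.
Proof.
move=> a0 ab; apply/eqP; rewrite subr_eq addrC; apply/eqP.
have e : [set` `]0, b]] = [set` `]0, a]] `|` [set` `]a, b]] :> set R.
  by rewrite -itv_bndbnd_setU//= bnd_simp ?ltW.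
rewrite /mass {1}e Rintegral_setU//.
  by rewrite -e; exact: mass_integrable.
apply/disj_setPS => x /= []; rewrite !in_itv/= => /andP[_ xa] /andP[ax _].
by have := le_lt_trans xa ax; rewrite ltxx.
Qed.

Lemma mass_bounds (a b : R) : 0 < a -> a <= b ->
  (b - a) * nu a <= mass nu b - mass nu a <= (b - a) * nu b.
Proof.
move=> a0 ab; rewrite massB// mass_increment_ge//=.
by rewrite mass_increment_le ?(ltW a0)// (lt_le_trans a0).
Qed.

Lemma mass_le (h : R) : 0 < h -> mass nu h <= h * nu h.
Proof.
by move=> h0; have := @mass_increment_le 0 h; rewrite subr0; apply => //; exact: ltW.
Qed.

Lemma mass_nd (a b : R) : 0 < a -> a <= b -> mass nu a <= mass nu b.
Proof.
move=> a0 ab; rewrite -subr_ge0; have /andP[+ _] := mass_bounds a0 ab.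
by apply: le_trans; rewrite mulr_ge0 ?subr_ge0// ltW//; have [] := nu_pos a0.
Qed.

Lemma mass_gt0 (h : R) : 0 < h -> 0 < mass nu h.
Proof.
move=> h0; have h2 : 0 < h / 2 by rewrite divr_gt0.
have h2h : h / 2 <= h by rewrite ler_pdivrMr// ler_peMr ?ler1n ?ltW.
have /andP[+ _] := mass_bounds h2 h2h.
have F0 : 0 <= mass nu (h / 2).
  apply: Rintegral_ge0 => x /=; rewrite in_itv/= => /andP[x0 _].
  by rewrite ltW//; have [] := nu_pos x0.
have [nu0 _] := nu_pos h2.
have : 0 < (h - h / 2) * nu (h / 2).
  by rewrite mulr_gt0// subr_gt0 ltr_pdivrMr// ltr_pMr// ltr1n.
by move=> /lt_le_trans h1 /h1; rewrite subr_gt0; exact: le_lt_trans.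
Qed.

(** Below [2 * h] monotonicity of [nu] makes the mass Lipschitz with constant [nu (2 * h)]. *)
Lemma mass_continuous (h : R) : 0 < h -> {for h, continuous (mass nu)}.
Proof.
move=> h0; have h2 : 0 < 2 * h by rewrite mulr_gt0.
have [nu0 _] := nu_pos h2.
have lip a b : 0 < a -> a <= b -> b <= 2 * h ->
    `|mass nu b - mass nu a| <= nu (2 * h) * `|b - a|.
  move=> a0 ab bh; rewrite !ger0_norm ?subr_ge0// ?mass_nd//.
  have /andP[_ /le_trans] := mass_bounds a0 ab; apply.
  by rewrite mulrC ler_wpM2r ?subr_ge0// nu_nd// (lt_le_trans a0).
apply/cvgrPdist_le => e e0; near=> x.
have x0 : 0 < x by near: x; exact: lt_nbhsr.
have x2 : x <= 2 * h.
    by apply: ltW; near: x; apply: lt_nbhsl; rewrite ltr_pMl// ltr1n.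
have xe : `|h - x| <= e / nu (2 * h).
  by near: x; apply: (@cvgr_dist_le _ _ _ (nbhs h)) => //; rewrite divr_gt0.
rewrite (@le_trans _ _ (nu (2 * h) * `|h - x|))//; last first.
  by rewrite mulrC -ler_pdivlMr.
have [xh|hx] := leP x h; first by rewrite lip// ler_peMl ?ler1n ?ltW.
by rewrite distrC (distrC h) lip// ltW.
Unshelve. all: by end_near. Qed.

End mass.

(** * Bandwidth equation and the slowly varying rate *)

Section bandwidth.
Context {R : realType} (s : R) (s01 : 0 < s <= 1) (omega nu rho : R -> R).
Context (omegaRV : RV s omega) (nuGV : GammaV rho nu).

Let omega_pos (h : R) : 0 < h -> 0 < omega h.
Proof. by have [op _] := omegaRV; move=> /op[]. Qed.

Let nu_pos : pos_continuous nu. Proof. by have [] := nuGV. Qed.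

Let nu_nd (a b : R) : 0 < a -> a <= b -> nu a <= nu b.
Proof. by have [_ _ + _] := nuGV; exact. Qed.

(* Positivity of h + y * rho h for negative y forces rho h / h --> 0, so that
   e^x h eventually lies above h + y * rho h for every y. *)
Lemma GammaV_rapid (x M : R) : 0 < x -> exists2 d : R, 0 < d &
  forall h, 0 < h -> h < d -> M * nu h <= nu (expR x * h).
Proof.
move=> x0; apply/near0rP; have [rho_pos _ _ lim] := nuGV.
have ex1 : 0 < expR x - 1 by rewrite subr_gt0 expR_gt1.
pose y := `|M| + 1; have y0 : 0 < y by rewrite ltr_wpDl.
(* At this negative argument, positivity reads [y * rho h < (expR x - 1) * h], that is,
   [h + y * rho h < expR x * h]. *)
have [_ limy] := lim y; have [near1 _] := lim (- (y / (expR x - 1))).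
have near2 : \forall h \near 0^'+, M < nu (h + y * rho h) / nu h.
  apply: (@cvgr_gt _ _ _ _ _ _ limy).
  rewrite (le_lt_trans (ler_norm _))// (lt_le_trans _ (expR_ge1Dx _))//.
  by rewrite /y addrC -addrA ltrDl.
near=> h; have h0 : 0 < h by [].
have [nuh _] := nu_pos h0; have [rhoh _] := rho_pos _ h0.
have : M < nu (h + y * rho h) / nu h by near: h.
rewrite ltr_pdivlMr// => /ltW/le_trans; apply; apply: nu_nd.
  by rewrite addr_gt0// mulr_gt0.
have : 0 < h + - (y / (expR x - 1)) * rho h by near: h.
rewrite mulNr subr_gt0 mulrAC ltr_pdivrMr// mulrBr mulr1 mulrC => ?; lra.
Unshelve. all: by end_near. Qed.

(** Between [expR (x / 2) * h] and [expR x * h], over a length proportional to [h], the density is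
    at least a large multiple of [nu h], whereas the whole mass up to [h] is at most [h * nu h]. *)
Lemma mass_rapid (x M : R) : 0 < x -> 0 < M -> exists2 d : R, 0 < d &
  forall h, 0 < h -> h < d -> M * mass nu h <= mass nu (expR x * h).
Proof.
move=> x0 M0; have x20 : 0 < x / 2 by rewrite divr_gt0.
pose l := expR x - expR (x / 2).
have l0 : 0 < l by rewrite subr_gt0 ltr_expR ltr_pdivrMr// ltr_pMr// ltr1n.
have [d d0 dP] := @GammaV_rapid (x / 2) (M / l) x20.
exists d => // h h0 hd; have := dP _ h0 hd.
set a := expR (x / 2) * h; set b := expR x * h => nuM.
have a0 : 0 < a by rewrite mulr_gt0 ?expR_gt0.
have ab : a <= b by rewrite ler_pM2r// -subr_ge0 ltW.
have /andP[+ _] := mass_bounds nu_pos nu_nd a0 ab.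
have Fa : 0 < mass nu a by exact: mass_gt0.
have Fh : mass nu h <= h * nu h by exact: mass_le.
rewrite -mulrBl -/l => le1.
have /le_trans : M * mass nu h <= M * (h * nu h) by rewrite ler_wpM2l// ltW.
apply; have -> : M * (h * nu h) = l * h * (M / l * nu h).
  by field; rewrite gt_eqF.
have /le_trans : l * h * (M / l * nu h) <= l * h * nu a.
  by rewrite ler_wpM2l// mulr_ge0// ltW.
apply; apply: (le_trans le1); rewrite gerBl; exact: (ltW Fa).
Qed.

(** G of the overview. Multiplied by [n / sigma ^+ 2] it compares the squared bias on the window
    with the variance of an average over the expected number of points. *)
Definition information h := 2 * omega h ^+ 2 * mass nu h.

Local Notation Q h := (information h / h).

Lemma information_gt0 h : 0 < h -> 0 < information h.
Proof. by move=> h0; rewrite !mulr_gt0 ?exprn_gt0 ?omega_pos ?mass_gt0. Qed.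

Let Q_gt0 h : 0 < h -> 0 < Q h.
Proof. by move=> h0; rewrite divr_gt0 ?information_gt0. Qed.

(** Since [omega] need not be monotone, the comparison advances by factors [expR z] so short that,
    by uniform convergence, [omega] loses at most a factor 2 on each. As [h] at most doubles, the
    quotient loses at most 8 against the gain of the mass. *)
Lemma information_growth (x M : R) : 0 < x -> 1 <= M ->
  exists2 d : R, 0 < d & forall h h', 0 < h -> expR x * h <= h' -> h' < d ->
    M * (information h / h) <= information h' / h'.
Proof.
move=> x0 M1.
have ln2 : 0 < ln 2 :> R by rewrite ln_gt0// ltr1n.
have s01' : 0 <= s <= 1 by case/andP: s01 => ? ->; rewrite ltW.
have [eta [d1 [eta0 d10 unif]]] := RV_uniform s01' omegaRV ln2.
(* Being at most [x] starts the chain, at most [eta] controls [omega], and at most [ln 2] lets [h]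
   at most double. *)
pose z := Num.min x (Num.min eta (ln 2)).
have z0 : 0 < z by rewrite !lt_min x0 eta0.
have zx : z <= x by rewrite ge_min lexx.
have zeta : z <= eta by rewrite !ge_min lexx orbT.
have z2 : expR z <= 2.
  by rewrite -[leRHS]lnK ?posrE// ler_expR !ge_min lexx !orbT.
(* One factor 8 in [64 * M] pays for a full step, the other for the final incomplete one. *)
have M640 : 0 < 64 * M by rewrite mulr_gt0// (lt_le_trans _ M1).
have [d2 d20 rapid] := @mass_rapid z (64 * M) z0 M640.
have omega_near h y : 0 < h -> h < d1 -> 0 <= y -> y <= z ->
    omega h / 2 <= omega (expR y * h).
  move=> h0 hd y0 yz.
  have := unif h y h0 hd y0 (le_trans yz zeta).
  rewrite ler_norml => /andP[+ _].
  rewrite lerBrDr addrC => le1.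
  rewrite -ler_ln ?posrE ?divr_gt0 ?omega_pos ?mulr_gt0 ?expR_gt0//.
  by rewrite ln_div ?posrE ?omega_pos.
have Qnear K h y : 0 <= K -> 0 < h -> h < d1 -> 0 <= y -> y <= z ->
    K * mass nu h <= mass nu (expR y * h) -> K / 8 * Q h <= Q (expR y * h).
  move=> K0 h0 hd y0 yz KF.
  have om := omega_near _ _ h0 hd y0 yz.
  rewrite /information.
  have ey2 : expR y <= 2 by rewrite (le_trans _ z2)// ler_expR.
  have ey0 := expR_gt0 y.
  rewrite [leRHS](_ : _ = 2 * omega (expR y * h) ^+ 2 * mass nu (expR y * h) / h / expR y); last first.
    by field; rewrite ?gt_eqF.
  rewrite ler_pdivlMr// (@le_trans _ _ (K / 8 * (2 * omega h ^+ 2 * mass nu h / h) * 2))//.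
    rewrite ler_wpM2l// !mulr_ge0 ?invr_ge0 ?exprn_ge0// ltW ?omega_pos ?mass_gt0//.
  rewrite [leLHS](_ : _ = 2 * (omega h / 2) ^+ 2 * (K * mass nu h) / h); last by field; rewrite gt_eqF.
  rewrite ler_wpM2r ?invr_ge0 ?(ltW h0)//.
  apply: ler_pM => //.
  - by rewrite mulr_ge0// exprn_ge0// divr_ge0// ltW ?omega_pos.
  - by rewrite mulr_ge0// ltW ?mass_gt0.
  - rewrite ler_pM2l// ler_pXn2r// nnegrE ?divr_ge0// ltW ?omega_pos// mulr_gt0 //.
exists (Num.min d1 d2); first by rewrite lt_min d10.
have chain j : forall h h', 0 < h -> expR z * h <= h' -> h' <= expR z ^+ j * h ->
    h' < Num.min d1 d2 -> M * Q h <= Q h'.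
  elim: j => [|j IH] h h' h0 zh hj; rewrite lt_min => /andP[hd1 hd2].
    have := le_trans zh hj; rewrite expr0 mul1r ger_pMl// expR_le1 leNgt z0.
    by [].
  have ezh : h <= expR z * h by rewrite ler_peMl ?ltW// expR_gt1.
  have hh' := le_trans ezh zh.
  have h''0 : 0 < expR z * h by rewrite mulr_gt0 ?expR_gt0.
  have zh_d1 := le_lt_trans zh hd1.
  have step : 8 * M * Q h <= Q (expR z * h).
    have := Qnear (64 * M) h z.
    rewrite (_ : 64 * M / 8 = 8 * M); last by field.
    apply => //; rewrite ?(le_lt_trans hh')// ?(ltW z0)//.
      by rewrite mulr_ge0// (le_trans _ M1).
    by apply: rapid; rewrite ?(le_lt_trans hh').
  (* In the final incomplete step the mass is merely non-decreasing, so a factor 8 is lost. *)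
  have [h'2|h'2] := leP h' (expR z * (expR z * h)).
    have h'0 : 0 < h' := lt_le_trans h0 hh'.
    pose y := ln (h' / (expR z * h)).
    have ey : expR y = h' / (expR z * h) by rewrite lnK// posrE divr_gt0.
    have h'E : h' = expR y * (expR z * h) by rewrite ey divfK ?gt_eqF.
    have y0 : 0 <= y by rewrite ln_ge0// ler_pdivlMr// mul1r.
    have yz : y <= z by rewrite -ler_expR ey ler_pdivrMr.
    rewrite h'E; have := Qnear 1 _ y ler01 h''0 zh_d1 y0 yz.
    rewrite mul1r -h'E => /(_ (mass_nd nu_pos nu_nd h''0 zh)).
    by rewrite h'E; lra.
  have := IH _ h' h''0 (ltW h'2).
  rewrite mulrA -exprSr lt_min hd1 hd2 => /(_ hj isT).
  have : M * Q (expR z * h) >= Q (expR z * h) by rewrite ler_peMl// ltW// Q_gt0.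
  have : 8 * M * Q h >= M * Q h.
    by rewrite -mulrA ler_peMl ?ler1n// mulr_ge0 ?(ltW (Q_gt0 _))// (le_trans _ M1).
  lra.
move=> h h' h0 xh h'd.
have h'0 : 0 < h' by rewrite (lt_le_trans _ xh)// mulr_gt0 ?expR_gt0.
have [j hj] := expR_exp_unbounded (h' / h) z0.
apply: (chain j) => //; last by rewrite -ler_pdivrMr// ltW.
by rewrite (le_trans _ xh)// ler_pM2r// ler_expR.
Qed.

(* A continuous approximate inverse of [information], which need not be
   monotone. As an infimum of affine functions of u it is concave. *)
Definition inv_information (u : R) : R :=
  inf [set h + u / (information h / h) | h in [set h : R | 0 < h]].

Local Notation H := inv_information.

Let uQ_gt0 u h : 0 < u -> 0 < h -> 0 < u / Q h.
Proof. by move=> u0 h0; rewrite divr_gt0// Q_gt0. Qed.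

Let H_lbound u : 0 < u ->
  lbound [set h + u / Q h | h in [set h : R | 0 < h]] 0.
Proof.
by move=> u0 _ [h h0 <-]; rewrite addr_ge0 ?(ltW h0) ?(ltW (uQ_gt0 _ _)).
Qed.

Let H_nonempty u : [set h + u / Q h | h in [set h : R | 0 < h]] !=set0.
Proof. by exists (1 + u / Q 1), 1 => /=. Qed.

Lemma inv_information_le (h u : R) : 0 < h -> 0 < u -> H u <= h + u / (information h / h).
Proof. by move=> h0 u0; apply: ge_inf; [exists 0; exact: H_lbound|exists h]. Qed.

Lemma inv_information_ge (u m : R) :
  (forall h, 0 < h -> m <= h + u / (information h / h)) -> m <= H u.
Proof. by move=> mP; apply: (lb_le_inf (H_nonempty u)) => _ [h h0 <-]; exact: mP. Qed.

(** Away from 0 the summand [h] is bounded below; for small [h], [Q h] is at most its value at a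
    fixed point, which bounds [u / Q h] below. *)
Lemma inv_information_gt0 (u : R) : 0 < u -> 0 < H u.
Proof.
move=> u0; have [d d0 dP] := @information_growth 1 1 ltr01 (lexx 1).
have h10 : 0 < d / 2 by rewrite divr_gt0.
have h1d : d / 2 < d by rewrite ltr_pdivrMr// ltr_pMr// ltr1n.
have m0 : 0 < Num.min (expR (-1) * (d / 2)) (u / Q (d / 2)).
  by rewrite lt_min mulr_gt0 ?expR_gt0//= uQ_gt0.
apply: (lt_le_trans m0); apply: inv_information_ge => h h0.
have Qh0 := Q_gt0 h0.
have [hd|hd] := leP (expR (-1) * (d / 2)) h.
  by rewrite ge_min (le_trans hd)// lerDl ltW// uQ_gt0.
rewrite ge_min; apply/orP; right; rewrite -[leLHS]add0r.
apply: lerD; first exact: ltW.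
rewrite ler_wpM2l ?(ltW u0)// lef_pV2 ?posrE ?Q_gt0//.
rewrite -[leLHS]mul1r; apply: dP => //.
by rewrite mulrC -ler_pdivlMr ?expR_gt0// -expRN mulrC ltW.
Qed.

Lemma inv_information_nd (u v : R) : 0 < u -> u <= v -> H u <= H v.
Proof.
move=> u0 uv; apply: inv_information_ge => h h0.
apply: (le_trans (inv_information_le h0 u0)).
by rewrite lerD2l ler_wpM2r// invr_ge0 (ltW (Q_gt0 h0)).
Qed.

Lemma inv_information_scale (u v : R) : 0 < u -> u <= v -> H v <= v / u * H u.
Proof.
move=> u0 uv; have v0 := lt_le_trans u0 uv.
rewrite -ler_pdivrMl ?divr_gt0//; apply: inv_information_ge => h h0.
rewrite ler_pdivrMl ?divr_gt0//; apply: (le_trans (inv_information_le h0 v0)).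
rewrite mulrDr; apply: lerD; first by rewrite ler_peMl ?(ltW h0)// ler_pdivlMr// mul1r.
by rewrite mulrA divfK ?gt_eqF.
Qed.

(** [H u] is non-decreasing and [H u / u] non-increasing, so [H v] lies between [H u] and
    [v / u * H u]. *)
Lemma inv_information_continuous (u : R) : 0 < u -> {for u, continuous H}.
Proof.
move=> u0; have Hu := inv_information_gt0 u0.
apply/cvgrPdist_le => e e0; near=> v.
have v0 : 0 < v by near: v; exact: lt_nbhsr.
have : `|u - v| <= e * u / H u.
  near: v; apply: (@cvgr_dist_le _ _ _ (nbhs u)) => //.
  by rewrite divr_gt0// mulr_gt0.
rewrite ler_pdivlMr// -ler_pdivrMr// => /(le_trans _); apply.
have [uv|/ltW vu] := leP u v.
  rewrite distrC ger0_norm ?subr_ge0 ?inv_information_nd//.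
  rewrite distrC ger0_norm ?subr_ge0// mulrAC mulrBl divff ?gt_eqF// mulrBl mul1r.
  by rewrite lerB// inv_information_scale.
rewrite ger0_norm ?subr_ge0 ?inv_information_nd//.
rewrite ger0_norm ?subr_ge0// mulrAC mulrBl divff ?gt_eqF// mulrBl mul1r.
rewrite lerB// -ler_pdivlMl ?divr_gt0// invf_div.
exact: inv_information_scale.
Unshelve. all: by end_near. Qed.

(** At [u = y * information h] the candidate [t] gives [t + y * h * Q h / Q t]. By rapid growth of
    [Q] the second term is negligible for [t] slightly above [h] and large for [t] slightly below,
    so the infimum is close to [h]. *)
Lemma inv_informationK (x y : R) : 0 < x -> 0 < y ->
  exists2 d : R, 0 < d & forall h, 0 < h -> h < d ->
    expR (- x) * h <= H (y * information h) <= expR x * h.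
Proof.
move=> x0 y0; have x20 : 0 < x / 2 by rewrite divr_gt0.
pose l := expR x - expR (x / 2).
have l0 : 0 < l by rewrite subr_gt0 ltr_expR ltr_pdivrMr// ltr_pMr// ltr1n.
(* [y / l] serves the upper bound, [y^-1] the lower one, and 1 meets the condition of
   [information_growth]. *)
pose M := 1 + y / l + y^-1.
have yl0 : 0 < y / l by rewrite divr_gt0.
have y'0 : 0 < y^-1 by rewrite invr_gt0.
have M1 : 1 <= M by rewrite /M -addrA lerDl addr_ge0// ltW.
have [d d0 dP] := information_growth x20 M1.
exists (expR (- (x / 2)) * d); first by rewrite mulr_gt0 ?expR_gt0.
move=> h h0 hd; have yh0 : 0 < y * information h by rewrite mulr_gt0 ?information_gt0.
have infE : y * information h = y * h * Q h by field; rewrite gt_eqF.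
have hd' : expR (x / 2) * h < d.
  by rewrite mulrC -ltr_pdivlMr ?expR_gt0// -expRN mulrC.
have hltd : h < d by rewrite (le_lt_trans _ hd')// ler_peMl ?(ltW h0)// ltW// expR_gt1.
apply/andP; split.
  apply: inv_information_ge => t t0; rewrite infE.
  have yhQ : 0 <= y * h * Q h / Q t.
    by rewrite ltW// uQ_gt0// mulr_gt0 ?Q_gt0// mulr_gt0.
  have [th|th] := leP (expR (- (x / 2)) * h) t.
    rewrite (@le_trans _ _ t) ?lerDl// (le_trans _ th)// ler_pM2r// ler_expR.
    by rewrite lerN2 ler_pdivrMr// ler_peMr ?ler1n// ltW.
  rewrite (@le_trans _ _ (y * h * Q h / Q t)) ?lerDr ?(ltW t0)//.
  rewrite (@le_trans _ _ h)//.
    by rewrite ler_piMl ?(ltW h0)// expR_le1 oppr_le0 ltW.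
  have -> : y * h * Q h / Q t = h * (y * Q h / Q t).
    by rewrite -!mulrA mulrCA.
  rewrite ler_peMr ?(ltW h0)// ler_pdivlMr ?Q_gt0// mul1r -ler_pdivrMl//.
  apply: (@le_trans _ _ (M * Q t)).
    by rewrite ler_wpM2r ?(ltW (Q_gt0 _))// /M lerDr addr_ge0 ?ltW.
  by apply: dP => //; rewrite mulrC -ler_pdivlMr ?expR_gt0// -expRN mulrC ltW.
set h' := expR (x / 2) * h; have h'0 : 0 < h' by rewrite mulr_gt0 ?expR_gt0.
apply: (le_trans (inv_information_le h'0 yh0)).
rewrite infE -lerBrDl /h' -mulrBl -/l ler_pdivrMr ?Q_gt0//.
rewrite (mulrC y) (mulrC l) -2!(mulrA h) ler_pM2l//.
rewrite -ler_pdivrMl// (mulrA l^-1) (mulrC l^-1).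
apply: (@le_trans _ _ (M * Q h)).
  by rewrite ler_wpM2r ?(ltW (Q_gt0 _))// /M -addrA addrCA lerDl addr_ge0 ?ltW.
by apply: dP.
Qed.

(** Both points differ by a factor of at most [expR eta], where [omega] is under uniform control.
    That control is for nonnegative exponents, so the smaller point serves as base. *)
Lemma omega_inv_information (y e : R) : 0 < y -> 0 < e ->
  exists2 d : R, 0 < d & forall h, 0 < h -> h < d ->
    `|ln (omega (H (y * information h))) - ln (omega h)| <= e.
Proof.
move=> y0 e0; have s01' : 0 <= s <= 1 by case/andP: s01 => ? ->; rewrite ltW.
have [eta [d1 [eta0 d10 unif]]] := RV_uniform s01' omegaRV e0.
have [d2 d20 near2] := inv_informationK eta0 y0.
exists (Num.min d2 (expR (- eta) * d1)).
  by rewrite lt_min d20 mulr_gt0 ?expR_gt0.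
move=> h h0; rewrite lt_min => /andP[hd2 hd1].
have := near2 h h0 hd2; set h' := H _ => /andP[lo up].
have hd1' : expR eta * h < d1 by rewrite mulrC -ltr_pdivlMr ?expR_gt0// -expRN mulrC.
have ltd1 : h < d1 by rewrite (le_lt_trans _ hd1')// ler_peMl ?(ltW h0)// ltW// expR_gt1.
have h'0 : 0 < h' by rewrite (lt_le_trans _ lo)// mulr_gt0 ?expR_gt0.
have [hh'|/ltW h'h] := leP h h'.
  have E : expR (ln (h' / h)) = h' / h by rewrite lnK// posrE divr_gt0.
  have -> : h' = expR (ln (h' / h)) * h by rewrite E divfK ?gt_eqF.
  apply: unif => //; first by rewrite ln_ge0// ler_pdivlMr// mul1r.
  by rewrite -ler_expR E ler_pdivrMr.
have E : expR (ln (h / h')) = h / h' by rewrite lnK// posrE divr_gt0.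
rewrite distrC; have -> : h = expR (ln (h / h')) * h' by rewrite E divfK ?gt_eqF.
apply: unif => //; first exact: le_lt_trans ltd1.
  by rewrite ln_ge0// ler_pdivlMr// mul1r.
by rewrite -ler_expR E ler_pdivrMr// -ler_pdivrMl ?expR_gt0// -expRN.
Qed.

Lemma information_continuous (h : R) : 0 < h -> {for h, continuous information}.
Proof.
move=> h0; apply: continuousM; last exact: (mass_continuous nu_pos nu_nd).
apply: continuousM; first exact: cvg_cst.
have [op _] := omegaRV; have [_ oc] := op _ h0.
apply: (@continuous_comp _ _ _ omega (fun x => x ^+ 2)) => //.
exact: exprn_continuous.
Qed.

(** Intermediate value theorem between [a] and [b], where
    [information a = a * Q a <= a * Q b <= u]. *)
Lemma information_onto (d : R) : 0 < d -> exists2 u0 : R, 0 < u0 &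
  forall u, 0 < u -> u < u0 -> exists h, [/\ 0 < h, h < d & information h = u].
Proof.
move=> d0; have [d1 d10 growth] := @information_growth 1 1 ltr01 (lexx 1).
pose b := Num.min d d1 / 2.
have m0 : 0 < Num.min d d1 by rewrite lt_min d0.
have b0 : 0 < b by rewrite divr_gt0.
have : b < Num.min d d1 by rewrite ltr_pdivrMr// ltr_pMr// ltr1n.
rewrite lt_min => /andP[bd bd1].
exists (information b); first exact: information_gt0.
move=> u u0 ub; pose a := Num.min (expR (-1) * b) (u / Q b).
have a0 : 0 < a by rewrite lt_min mulr_gt0 ?expR_gt0//= uQ_gt0.
have ab : expR 1 * a <= b.
  by rewrite mulrC -ler_pdivlMr ?expR_gt0// -expRN mulrC ge_min lexx.
have aleb : a <= b by rewrite (le_trans _ ab)// ler_peMl ?(ltW a0)// ltW// expR_gt1.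
have au : information a <= u.
  have := growth a b a0 ab bd1; rewrite mul1r ler_pdivrMr// => /le_trans; apply.
  by rewrite mulrC -ler_pdivlMr ?Q_gt0// ge_min lexx orbT.
have [| |c] := @IVT _ information a b u aleb.
- apply: continuous_in_subspaceT => x; rewrite inE /= in_itv /= => /andP[ax _].
  by apply: information_continuous; exact: lt_le_trans ax.
- by rewrite ge_min au le_max (ltW ub) orbT.
rewrite in_itv /= => /andP[ac cb] cu; exists c; split => //.
  exact: lt_le_trans ac.
exact: le_lt_trans bd.
Qed.

(** The slowly varying function of the theorem; it depends on [omega] and [nu] but not on
    [sigma]. *)
Definition rate u := omega (H u).

(** A small [u] has the form [information h], and on the logarithmic scale both [rate (y * u)] and
    [rate u] are close to [omega h]. *)
Lemma rate_slowly_varying : slowly_varying rate.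
Proof.
split=> [u u0|y y0].
  have Hu := inv_information_gt0 u0; split; first exact: omega_pos.
  apply: (@continuous_comp _ _ _ H omega); first exact: inv_information_continuous.
  by have [op _] := omegaRV; have [] := op _ Hu.
rewrite powRr0.
have lim : ln (rate (y * u)) - ln (rate u) @[u --> 0^'+] --> 0.
  apply/cvgrPdist_le => e e0; apply/near0rP.
  have e20 : 0 < e / 2 by rewrite divr_gt0.
  have [d1 d10 near1] := omega_inv_information y0 e20.
  have [d2 d20 near2] := omega_inv_information ltr01 e20.
  have d0 : 0 < Num.min d1 d2 by rewrite lt_min d10.
  have [u0 u00 onto] := information_onto d0; exists u0 => // u u_gt0 uu0.
  have [h [h0 + hu]] := onto _ u_gt0 uu0.
  rewrite lt_min => /andP[/(near1 _ h0) + /(near2 _ h0)].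
  rewrite hu mul1r sub0r normrN /rate !ler_norml => /andP[? ?] /andP[? ?].
  by apply/andP; split; lra.
have := cvg_comp _ _ lim (@continuous_expR R 0); rewrite expR0.
apply: cvg_trans; apply: near_eq_cvg; near=> u.
have u0 : 0 < u by [].
have ru : 0 < rate u by rewrite omega_pos// inv_information_gt0.
have ryu : 0 < rate (y * u) by rewrite omega_pos// inv_information_gt0// mulr_gt0.
by rewrite /= expRB !lnK ?posrE.
Unshelve. all: by end_near. Qed.

Lemma bandwidth_eqE (sigma : R) (n : nat) (h : R) : 0 < sigma -> (0 < n)%N -> 0 < h ->
  bandwidth_eq omega nu sigma n h <-> information h = sigma ^+ 2 / n%:R.
Proof.
move=> sg0 n0 h0; have n0' : 0 < n%:R :> R by rewrite ltr0n.
rewrite /bandwidth_eq /information -/(mass nu h).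
have F0 : 0 < mass nu h by exact: mass_gt0.
have A0 : 0 < 2 * n%:R * mass nu h by rewrite !mulr_gt0.
have S0 : 0 < Num.sqrt (2 * n%:R * mass nu h) by rewrite sqrtr_gt0.
have oh := omega_pos h0.
split=> [->|E].
  rewrite expr_div_n sqr_sqrtr ?ltW//; field.
  by rewrite !gt_eqF.
apply/eqP; rewrite -(@eqrXn2 _ 2)// ?ltW//; last by rewrite divr_gt0.
rewrite expr_div_n sqr_sqrtr ?ltW//; apply/eqP.
have -> : sigma ^+ 2 = 2 * omega h ^+ 2 * mass nu h * n%:R by rewrite E divfK ?gt_eqF.
by field; rewrite !gt_eqF.
Qed.

(** For large [n] the bandwidth equation has a solution below [d], and the smallest solution is no
    larger. *)
Lemma smallest_bandwidth_cvg0 (sigma : R) (h : nat -> R) : 0 < sigma ->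
  (\forall n \near \oo, smallest_bandwidth omega nu sigma n (h n)) ->
  forall d, 0 < d -> \forall n \near \oo, h n < d.
Proof.
move=> sg0 hh d d0; have [u0 u00 onto] := information_onto d0.
near=> n.
have n0 : (0 < n)%N by near: n; exists 1%N.
have n0' : 0 < n%:R :> R by rewrite ltr0n.
have [hn0 _ hmin] : smallest_bandwidth omega nu sigma n (h n) by near: n.
have un : sigma ^+ 2 / n%:R < u0.
  rewrite ltr_pdivrMr// mulrC -ltr_pdivrMr//; near: n; exact: nbhs_infty_gtr.
have [|h' [h'0 h'd /bandwidth_eqE]] := onto (sigma ^+ 2 / n%:R) _ un.
  by rewrite divr_gt0// exprn_gt0.
by move=> /(_ sg0 n0 h'0) /(hmin _ h'0) /le_lt_trans; apply.
Unshelve. all: by end_near. Qed.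

(** With [y = (sigma ^+ 2)^-1], the product [y * information (h n)] is exactly the inverse of
    [n]. *)
Lemma rate_bandwidth (sigma : R) (h : nat -> R) : 0 < sigma ->
  (\forall n \near \oo, smallest_bandwidth omega nu sigma n (h n)) ->
  \forall n \near \oo, rate n%:R^-1 / 2 <= omega (h n) <= 2 * rate n%:R^-1.
Proof.
move=> sg0 hh; have ln2 : 0 < ln 2 :> R by rewrite ln_gt0// ltr1n.
have s20 : 0 < (sigma ^+ 2)^-1 by rewrite invr_gt0 exprn_gt0.
have [d d0 dP] := omega_inv_information s20 ln2.
near=> n.
have n0 : (0 < n)%N by near: n; exists 1%N.
have n0' : 0 < n%:R :> R by rewrite ltr0n.
have [hn0 hn _] : smallest_bandwidth omega nu sigma n (h n) by near: n.
have hnd : h n < d by near: n; exact: (smallest_bandwidth_cvg0 sg0 hh).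
have := dP _ hn0 hnd; have := (bandwidth_eqE sg0 n0 hn0).1 hn => ->.
rewrite mulrA mulVf ?gt_eqF ?exprn_gt0// mul1r -/(rate _).
have r0 : 0 < rate n%:R^-1 by rewrite omega_pos// inv_information_gt0// invr_gt0.
have o0 := omega_pos hn0.
rewrite ler_norml => /andP[? ?].
apply/andP; split; rewrite -ler_ln ?posrE ?divr_gt0 ?mulr_gt0//.
  by rewrite ln_div ?posrE//; lra.
by rewrite lnM ?posrE//; lra.
Unshelve. all: by end_near. Qed.

End bandwidth.

(** * Gaussian and product integrals *)

Section density.
Context d (T : measurableType d) (R : realType).
Local Open Scope ereal_scope.
Import HBNNSimple.

(** The hypothesis [mE] settles indicators, linearity simple functions, and monotone convergence the
    rest. *)
Lemma ge0_integral_density (m mu : {measure set T -> \bar R}) (g : T -> R) :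
  measurable_fun [set: T] g -> (forall x, (0 <= g x)%R) ->
  (forall A, measurable A -> m A = \int[mu]_(x in A) (g x)%:E) ->
  forall f : T -> \bar R, measurable_fun [set: T] f -> (forall x, 0 <= f x) ->
  \int[m]_x f x = \int[mu]_x (f x * (g x)%:E).
Proof.
move=> mg g0 mE f mf f0.
pose f_ := nnsfun_approx measurableT mf.
transitivity (limn (fun n => \int[m]_x (f_ n x)%:E)).
  rewrite -monotone_convergence//.
  - apply: eq_integral => x _; apply/esym/cvg_lim => //.
    exact: cvg_nnsfun_approx.
  - by move=> n; exact/measurable_EFinP/measurable_funP.
  - by move=> n x _; rewrite lee_fin.
  - by move=> x _ a b ab; rewrite lee_fin; exact/lefP/nd_nnsfun_approx.
transitivity (limn (fun n => \int[mu]_x ((f_ n x)%:E * (g x)%:E))); last first.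
  rewrite -monotone_convergence//.
  - apply: eq_integral => x _; apply/cvg_lim => //.
    by apply: cvgeZr => //; exact: cvg_nnsfun_approx.
  - move=> n; apply: emeasurable_funM; last exact/measurable_EFinP.
    exact/measurable_EFinP/measurable_funP.
  - by move=> n x _; rewrite mule_ge0// lee_fin.
  - move=> x _ a b ab; rewrite lee_wpmul2r ?lee_fin//.
    exact/lefP/nd_nnsfun_approx.
congr (limn _); apply/funext => n.
under eq_integral do rewrite fimfunE -fsumEFin//.
rewrite ge0_integral_fsum//; last 2 first.
  - by move=> r; exact/measurable_EFinP/measurableT_comp.
  - by move=> r x _; rewrite EFinM nnfun_muleindic_ge0.
under [RHS]eq_integral.
  move=> x _; rewrite fimfunE -fsumEFin// ge0_mule_fsuml; last first.
    by move=> r; rewrite EFinM nnfun_muleindic_ge0.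
  over.
rewrite ge0_integral_fsum//; last 2 first.
  - move=> r; apply: emeasurable_funM; last exact/measurable_EFinP.
    exact/measurable_EFinP/measurableT_comp.
  - move=> r x _; apply: mule_ge0; last by rewrite lee_fin.
    by rewrite EFinM nnfun_muleindic_ge0.
apply: eq_fsbigr => r _.
rewrite integralZl_indic_nnsfun// integral_indic// setIT mE//.
have [r0|r0] := ltP r 0%R.
  rewrite preimage_nnfun0// integral_set0 mule0.
  by rewrite integral0_eq// => x _; rewrite indicE in_set0 mulr0 mul0e.
rewrite integral_mkcond -ge0_integralZl_EFin//; last 2 first.
- by move=> x _; rewrite patchE; case: ifPn => // _; rewrite lee_fin.
- apply/(measurable_restrictT _ _).1 => //.
  exact/measurable_funTS/measurable_EFinP.
apply: eq_integral => x _; rewrite patchE indicE EFinM.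
by case: ifPn => _; rewrite ?mule1// mule0 mul0e.
Qed.

End density.

(** * Translation of Lebesgue and normal measures *)

Section normal_shift.
Context {R : realType}.
Local Notation mR := (measurableTypeR R).
Local Open Scope ereal_scope.

Lemma measurable_addl (a : R) : measurable_fun [set: mR] (fun x : mR => (a + x)%R : mR).
Proof. exact: measurable_funD. Qed.

(** By uniqueness of Lebesgue measure it suffices to compare lengths of half-open intervals. *)
Lemma lebesgue_measure_shift (a : R) (A : set mR) : measurable A ->
  pushforward (@lebesgue_measure R) (fun x : mR => (a + x)%R : mR) A =
  lebesgue_measure A.
Proof.
pose mx := isMeasurableFun.Build _ _ _ _ _ (measurable_addl a).
pose sh : {mfun mR >-> mR} := HB.pack (fun x : mR => (a + x)%R : mR) mx.
move=> mA; apply/esym.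
apply: (@lebesgue_measure_unique R (pushforward lebesgue_measure sh)) => //= _ [[b c]] _ <-.
rewrite /pushforward.
have -> : (sh @^-1` [set` `]b, c]]) = [set` `](b - a)%R, (c - a)%R]] :> set R.
  by apply/seteqP; split => x /=; rewrite !in_itv/= ltrBlDl lerBrDl.
by rewrite !lebesgue_measure_itv/= !lte_fin ltrBlDr subrK -!EFinB opprB addrA subrK.
Qed.

Lemma ge0_integral_shift (a : R) (f : mR -> \bar R) :
  measurable_fun [set: mR] f -> (forall x, 0 <= f x) ->
  \int[lebesgue_measure]_x f (a + x)%R = \int[lebesgue_measure]_x f x.
Proof.
move=> mf f0.
have := @ge0_integral_pushforward _ _ _ _ _ _ (measurable_addl a)
  (@lebesgue_measure R) setT f measurableT mf (fun x _ => f0 x).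
rewrite preimage_setT => <-.
apply: eq_measure_integral => [|ms A mA _]; first exact: measurable_addl.
exact: lebesgue_measure_shift.
Qed.

Lemma normal_pdf_shift (a sigma x : R) : (0 < sigma)%R ->
  (normal_pdf 0 sigma (x - a) =
   expR ((a * x - a ^+ 2 / 2) / sigma ^+ 2) * normal_pdf 0 sigma x)%R.
Proof.
move=> s0; rewrite !normal_pdfE ?gt_eqF// /normal_fun mulrCA -expRD.
by congr (_ * expR _)%R; field; rewrite gt_eqF.
Qed.

(** The Cameron-Martin formula in dimension one: shifting the noise by [a] amounts to weighting by
    the ratio of two normal densities. *)
Lemma ge0_integral_normal_shift (a sigma : R) (f : mR -> \bar R) : (0 < sigma)%R ->
  measurable_fun [set: mR] f -> (forall x, 0 <= f x) ->
  \int[normal_prob 0 sigma]_x f (a + x)%R =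
  \int[normal_prob 0 sigma]_x
    (f x * (expR ((a * x - a ^+ 2 / 2) / sigma ^+ 2))%:E).
Proof.
move=> s0 mf f0.
have dens := @ge0_integral_density _ mR R (normal_prob 0 sigma) lebesgue_measure
  (normal_pdf 0 sigma) (measurable_normal_pdf 0 sigma)
  (normal_pdf_ge0 0 sigma) (fun A _ => erefl).
have mexp : measurable_fun [set: mR]
    (fun x : mR => expR ((a * x - a ^+ 2 / 2) / sigma ^+ 2)).
  apply: measurableT_comp => //; apply: measurable_funM => //.
  by apply: measurable_funB => //; exact: measurable_funM.
rewrite dens//; last exact: (measurableT_comp mf (measurable_addl a)).
rewrite [RHS]dens//; last 2 first.
- by apply: emeasurable_funM => //; exact/measurable_EFinP.
- by move=> x; rewrite mule_ge0// lee_fin expR_ge0.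
rewrite -[LHS](@ge0_integral_shift (- a)); last 2 first.
- apply: emeasurable_funM; first exact: (measurableT_comp mf (measurable_addl a)).
  have mp : measurable_fun [set: mR] (normal_pdf 0 sigma).
    exact: measurable_normal_pdf.
  exact/measurable_EFinP.
- by move=> x; apply: mule_ge0 => //; rewrite lee_fin normal_pdf_ge0.
apply: eq_integral => x _; rewrite addrA subrr add0r -muleA -EFinM.
by rewrite addrC normal_pdf_shift.
Qed.

(* The moment generating function is the shift lemma for f = 1. *)
Lemma normal_mgf (t sigma : R) : (0 < sigma)%R ->
  \int[normal_prob 0 sigma]_x (expR (t * x))%:E =
  (expR (t ^+ 2 * sigma ^+ 2 / 2))%:E.
Proof.
move=> s0; have mt : measurable_fun [set: mR] (fun x : mR => (expR (t * x))%:E).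
  by apply/measurable_EFinP; apply: measurableT_comp => //; exact: measurable_funM.
(* The shift [t * sigma ^+ 2] makes the density ratio proportional to [expR (t * x)]. *)
have := @ge0_integral_normal_shift (t * sigma ^+ 2)%R sigma (cst 1) s0
  (measurable_cst _) (fun=> lee01).
have -> : \int[normal_prob 0 sigma]_(x in [set: mR]) cst 1 (t * sigma ^+ 2 + x)%R = 1.
  by rewrite /= integral_cst// mul1e; exact: probability_setT.
under eq_integral => x _.
  rewrite mul1e.
  have -> : ((t * sigma ^+ 2 * x - (t * sigma ^+ 2) ^+ 2 / 2) / sigma ^+ 2 =
      - (t ^+ 2 * sigma ^+ 2 / 2) + t * x)%R by field; rewrite gt_eqF.
  rewrite expRD EFinM.
  over.
rewrite ge0_integralZl//=.
move=> /(congr1 (fun z => (expR (t ^+ 2 * sigma ^+ 2 / 2))%:E * z)).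
by rewrite mule1 muleA -EFinM -expRD subrr expR0 mul1e => ->.
Qed.

End normal_shift.

(** * Integrals against product laws *)

Section iid_integrals.
Context d (T : measurableType d) (R : realType).
Local Open Scope ereal_scope.
Implicit Types P : probability T R.

Lemma ge0_integral_iidS P n (f : n.+1.-tuple T -> \bar R) :
  measurable_fun [set: _] f -> (forall z, 0 <= f z) ->
  \int[iid_law P n.+1]_z f z =
  \int[P]_x \int[iid_law P n]_z f [the n.+1.-tuple T of x :: z].
Proof.
move=> mf f0.
rewrite [LHS]ge0_integral_distribution//.
have mfc : measurable_fun [set: T * n.-tuple T] (f \o @tuple_cons d T n).
  by apply: measurableT_comp => //; exact: measurable_tuple_cons.
by rewrite fubini_tonelli1//= => z; exact: f0.
Qed.

Lemma measurable_iid_section P n (f : n.+1.-tuple T -> \bar R) :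
  measurable_fun [set: _] f -> (forall z, 0 <= f z) ->
  measurable_fun [set: T]
    (fun x => \int[iid_law P n]_z f [the n.+1.-tuple T of x :: z]).
Proof.
move=> mf f0.
have mfc : measurable_fun [set: T * n.-tuple T] (f \o @tuple_cons d T n).
  by apply: measurableT_comp => //; exact: measurable_tuple_cons.
exact: (@measurable_fun_fubini_tonelli_F _ _ _ _ _ (iid_law P n)
  (f \o @tuple_cons d T n) mfc (fun z => f0 _)).
Qed.

(** Serves both as the likelihood ratio of [n] observations and as the exponential of a sum over
    them. *)
Definition tuple_prod n (l : T -> R) (z : n.-tuple T) : R :=
  (\prod_(i < n) l (tnth z i))%R.

Lemma tuple_prod_cons n (l : T -> R) x (z : n.-tuple T) :
  tuple_prod l [the n.+1.-tuple T of x :: z] = (l x * tuple_prod l z)%R.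
Proof.
rewrite /tuple_prod big_ord_recl; congr (_ * _)%R.
by apply: eq_bigr => i _; rewrite tnthS.
Qed.

Lemma tuple_prod_ge0 n (l : T -> R) (z : n.-tuple T) :
  (forall x, 0 <= l x)%R -> (0 <= tuple_prod l z)%R.
Proof. by move=> l0; apply: prodr_ge0. Qed.

Lemma measurable_tuple_prod n (l : T -> R) : measurable_fun [set: T] l ->
  measurable_fun [set: n.-tuple T] (tuple_prod l).
Proof.
move=> ml; rewrite /tuple_prod; apply: measurable_prod => i _.
by apply: measurableT_comp => //; exact: measurable_tnth.
Qed.

Lemma emeasurable_tuple_prod n (l : T -> R) : measurable_fun [set: T] l ->
  measurable_fun [set: n.-tuple T] (fun z => (tuple_prod l z)%:E).
Proof. by move=> ml; apply/measurable_EFinP; exact: measurable_tuple_prod. Qed.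

Lemma integral_iid_prod P (l : T -> R) (c : R) n :
  measurable_fun [set: T] l -> (forall x, 0 <= l x)%R ->
  \int[P]_x (l x)%:E = c%:E ->
  \int[iid_law P n]_z (tuple_prod l z)%:E = (c ^+ n)%:E.
Proof.
move=> ml l0 lc; elim: n => [|n IH].
  rewrite /= integral_dirac//; last exact: emeasurable_tuple_prod.
  by rewrite diracT mul1e /tuple_prod big_ord0 expr0.
rewrite ge0_integral_iidS; last 2 first.
- exact: emeasurable_tuple_prod.
- by move=> z; rewrite lee_fin tuple_prod_ge0.
transitivity (\int[P]_x ((l x)%:E * (c ^+ n)%:E)).
  apply: eq_integral => x _; rewrite -IH -ge0_integralZl_EFin//.
  - by apply: eq_integral => z _; rewrite tuple_prod_cons EFinM.
  - by move=> z _; rewrite lee_fin tuple_prod_ge0.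
  - exact: emeasurable_tuple_prod.
have c0 : (0 <= c)%R.
  by rewrite -lee_fin -lc; apply: integral_ge0 => x _; rewrite lee_fin.
rewrite ge0_integralZr ?lee_fin ?exprn_ge0//.
- by rewrite lc -EFinM exprS.
- exact/measurable_EFinP.
- by move=> x _; rewrite lee_fin.
Qed.

(** Densities multiply under independence: Tonelli peels off the first observation. *)
Lemma integral_iid_change P0 P1 (l : T -> R) n :
  measurable_fun [set: T] l -> (forall x, 0 <= l x)%R ->
  (forall f : T -> \bar R, measurable_fun [set: T] f -> (forall x, 0 <= f x) ->
    \int[P1]_x f x = \int[P0]_x (f x * (l x)%:E)) ->
  forall f : n.-tuple T -> \bar R, measurable_fun [set: _] f ->
    (forall z, 0 <= f z) ->
  \int[iid_law P1 n]_z f z =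
  \int[iid_law P0 n]_z (f z * (tuple_prod l z)%:E).
Proof.
move=> ml l0 P10; elim: n => [|n IH] f mf f0.
  rewrite /= !integral_dirac//; last first.
    apply: emeasurable_funM => //.
    exact: emeasurable_tuple_prod.
  by rewrite /tuple_prod big_ord0 mule1.
have mfl : measurable_fun [set: n.+1.-tuple T] (fun z => f z * (tuple_prod l z)%:E).
  apply: emeasurable_funM => //.
  exact: emeasurable_tuple_prod.
have fl0 z : 0 <= f z * (tuple_prod l z)%:E.
  by rewrite mule_ge0// lee_fin tuple_prod_ge0.
rewrite !ge0_integral_iidS// P10; last 2 first.
- exact: measurable_iid_section.
- by move=> x; exact: integral_ge0.
apply: eq_integral => x _.
have mfx : measurable_fun [set: n.-tuple T] (fun z => f [the n.+1.-tuple T of x :: z]).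
  by apply: measurableT_comp => //; exact: measurable_cons.
rewrite IH//.
under [RHS]eq_integral => z _ do rewrite tuple_prod_cons (mulrC (l x)) EFinM muleA.
rewrite ge0_integralZr ?lee_fin//.
- apply: emeasurable_funM => //.
  exact: emeasurable_tuple_prod.
- by move=> z _; rewrite mule_ge0// lee_fin tuple_prod_ge0.
Qed.

End iid_integrals.

Section pair_law.
Context {R : realType}.
Local Notation mR := (measurableTypeR R).
Local Open Scope ereal_scope.
Implicit Types (PX : probability mR R) (f : {mfun mR >-> R}).

Lemma ge0_integral_pair_law PX sigma f (F : R * R -> \bar R) :
  measurable_fun [set: R * R] F -> (forall z, 0 <= F z) ->
  \int[pair_law PX sigma f]_z F z =
  \int[PX]_x \int[normal_prob 0 sigma]_e F (x, f x + e)%R.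
Proof.
move=> mF F0.
rewrite [LHS]ge0_integral_distribution//.
have mFo : measurable_fun [set: mR * mR] (F \o observe f).
  by apply: measurableT_comp => //; exact: measurable_observe.
by rewrite fubini_tonelli1//= => z; exact: F0.
Qed.

End pair_law.

(** * Lower bound *)

Section mixture.
Context {R : realType}.
Local Notation mR := (measurableTypeR R).

(** Once the noise is integrated out, squared likelihoods and generating functions depend on X only
    through membership in the window; this gives their mean. *)
Lemma integral_mixture (PX : probability mR R) (B : set mR) (q a : R) :
  measurable B -> PX B = q%:E -> 0 <= a ->
  (\int[PX]_x (if x \in B then a else 1)%:E)%E = (1 + q * (a - 1))%:E.
Proof.
move=> mB PB a0.
have mBC : measurable (~` B) by exact: measurableC.
transitivity (\int[PX]_x (a%:E * (\1_B x)%:E + (\1_(~` B) x)%:E))%E.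
  apply: eq_integral => x _; rewrite !indicE in_setC.
  by case: (x \in B); rewrite /= ?mule1 ?adde0 ?mule0 ?add0e.
rewrite ge0_integralD//=.
- rewrite ge0_integralZl_EFin//; last exact/measurable_EFinP/measurable_indic.
  rewrite !integral_indic// !setIT.
  transitivity (a%:E * q%:E + (1 - q%:E))%E.
    congr (_ * _ + _)%E; first exact: PB.
    by have := probability_setC PX mB; rewrite PB.
  by rewrite -EFinM -EFinB -EFinD; congr (_%:E); ring.
- by move=> x _; rewrite mule_ge0// lee_fin.
- by apply: emeasurable_funM => //; exact/measurable_EFinP/measurable_indic.
- exact/measurable_EFinP/measurable_indic.
Qed.

(** From [1 - u <= expR (- u)] follows [expR u - 1 <= u * expR u <= u * expR 1]; the power is
    handled by [1 + x <= expR x]. *)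
Lemma mixture_expR_bound (q u : R) n : 0 <= q -> 0 <= u -> u <= 1 ->
  n%:R * q * u <= 1 -> (1 + q * (expR u - 1)) ^+ n <= expR (expR 1).
Proof.
move=> q0 u0 u1 nqu.
have v0 : 0 <= expR u - 1 by rewrite subr_ge0 -expR0 ler_expR.
have vu : expR u - 1 <= u * expR 1.
  have : 1 - u <= expR (- u) by exact: expR_ge1Dx.
  rewrite expRN -[leRHS]mul1r ler_pdivlMr ?expR_gt0// => h.
  have : u * expR u <= u * expR 1 by rewrite ler_wpM2l// ler_expR.
  lra.
apply: (@le_trans _ _ (expR (q * (expR u - 1)) ^+ n)).
  rewrite lerXn2r ?nnegrE ?expR_ge0 ?expR_ge1Dx//.
  by rewrite addr_ge0// mulr_ge0.
rewrite -expRM_natl ler_expR mulrA.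
apply: (@le_trans _ _ (n%:R * q * (u * expR 1))).
  by rewrite ler_wpM2l// mulr_ge0.
by rewrite mulrA ler_piMl// expR_ge0.
Qed.

End mixture.

(** * Likelihood ratio against the zero function *)

Section likelihood.
Context {R : realType}.
Local Notation mR := (measurableTypeR R).
Context (PX : probability mR R) (sigma : R) (sigma0 : 0 < sigma).
Implicit Type f : {mfun mR >-> R}.

(** Density of the law of a pair under [f] relative to its law under the zero function. *)
Definition likelihood f (z : R * R) : R :=
  expR ((f z.1 * z.2 - f z.1 ^+ 2 / 2) / sigma ^+ 2).

Lemma measurable_comp_fst f : measurable_fun [set: R * R] (fun z => f z.1).
Proof. by apply: (measurableT_comp (measurable_funPT f)); exact: measurable_fst. Qed.

Lemma measurable_likelihood f : measurable_fun [set: R * R] (likelihood f).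
Proof.
have mf := measurable_comp_fst f.
apply: measurableT_comp => //; apply: measurable_funM => //.
apply: measurable_funB.
  by apply: measurable_funM => //; exact: measurable_snd.
by apply: measurable_funM => //; exact: measurable_funX.
Qed.

Lemma pair_law_likelihood f (F : R * R -> \bar R) :
  measurable_fun [set: R * R] F -> (forall z, 0 <= F z)%E ->
  (\int[pair_law PX sigma f]_z F z =
   \int[pair_law PX sigma (0%R : {mfun mR >-> R})]_z (F z * (likelihood f z)%:E))%E.
Proof.
move=> mF F0; have ml := measurable_likelihood f.
have mFl : measurable_fun [set: R * R] (fun z => F z * (likelihood f z)%:E)%E.
  by apply: emeasurable_funM => //; exact/measurable_EFinP.
have Fl0 z : (0 <= F z * (likelihood f z)%:E)%E.
  by rewrite mule_ge0// lee_fin expR_ge0.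
rewrite [LHS](ge0_integral_pair_law PX sigma f mF F0).
rewrite [RHS](ge0_integral_pair_law PX sigma 0%R mFl Fl0).
apply: eq_integral => x _.
have mFx : measurable_fun [set: mR] (fun y : mR => F (x, y)).
  by apply: measurableT_comp => //; exact: measurable_pair1.
rewrite (ge0_integral_normal_shift (f x) sigma0 mFx (fun y => F0 (x, y))).
by apply: eq_integral => y _; rewrite /= add0r.
Qed.

(** Given X, the moment generating function at [2 * f X / sigma ^+ 2] gives the squared likelihood
    the mean [expR (f X ^+ 2 / sigma ^+ 2)], which is 1 off [B]. *)
Lemma integral_likelihood_sq (B : set mR) (q r : R) f : measurable B ->
  PX B = q%:E -> (forall x, f x = r * \1_B x) ->
  (\int[pair_law PX sigma (0%R : {mfun mR >-> R})]_z (likelihood f z ^+ 2)%:E =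
   (1 + q * (expR (r ^+ 2 / sigma ^+ 2) - 1))%:E)%E.
Proof.
move=> mB PB fE; have ml := measurable_likelihood f.
have ml2 : measurable_fun [set: R * R] (fun z => (likelihood f z ^+ 2)%:E).
  by apply/measurable_EFinP; exact: measurable_funX.
have l20 z : (0 <= (likelihood f z ^+ 2)%:E)%E by rewrite lee_fin sqr_ge0.
rewrite [LHS](ge0_integral_pair_law PX sigma 0%R ml2 l20).
rewrite -(integral_mixture mB PB (expR_ge0 _)); apply: eq_integral => x _.
transitivity (\int[normal_prob 0 sigma]_(e in [set: mR])
   ((expR (- (f x ^+ 2 / sigma ^+ 2)))%:E * (expR (2 * f x / sigma ^+ 2 * e))%:E))%E.
  apply: eq_integral => e _; rewrite /likelihood /= add0r -EFinM -expRM_natl -expRD.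
  by congr (expR _)%:E; field; rewrite gt_eqF.
rewrite ge0_integralZl_EFin ?expR_ge0//; last first.
  by apply/measurable_EFinP; apply: measurableT_comp => //; exact: measurable_funM.
rewrite normal_mgf// -EFinM -expRD fE indicE.
case: (x \in B) => /=.
  by congr (expR _)%:E; field; rewrite gt_eqF.
by rewrite !(mulr0, expr0n, mul0r, oppr0, add0r)/= expR0.
Qed.

End likelihood.

Section lower_bound.
Context {R : realType}.
Local Notation mR := (measurableTypeR R).
Context (PX : probability mR R) (sigma : R) (sigma0 : 0 < sigma).
Implicit Type f : {mfun mR >-> R}.

Lemma measurable_loss n f (x0 p : R) (T : {mfun n.-tuple (R * R) >-> R}) :
  measurable_fun [set: n.-tuple (R * R)] (fun z => (`|T z - f x0| `^ p)%:E).
Proof.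
apply/measurable_EFinP; apply: (measurableT_comp (measurable_powR p)).
apply: measurableT_comp => //; apply: measurable_funB => //.
Qed.

(** Markov's inequality, on an event that forces an error of at least [delta]. *)
Lemma risk_markov n f (x0 p delta : R) (T : {mfun n.-tuple (R * R) >-> R})
    (A : set (n.-tuple (R * R))) : 0 < p -> 0 <= delta ->
  measurable A -> (forall z, A z -> delta <= `|T z - f x0|) ->
  ((delta `^ p)%:E * joint_law PX sigma f n A <= pointwise_risk PX sigma p x0 f T)%E.
Proof.
move=> p0 d0 mA dA; rewrite /pointwise_risk.
rewrite -(setIT A) -(integral_indic _ measurableT mA).
rewrite -ge0_integralZl_EFin ?powR_ge0//; last exact/measurable_EFinP/measurable_indic.
apply: ge0_le_integral => //.
- by move=> z _; rewrite mule_ge0// lee_fin// powR_ge0.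
- by apply: emeasurable_funM => //; exact/measurable_EFinP/measurable_indic.
- exact: measurable_loss.
move=> z _; rewrite indicE -EFinM lee_fin.
have [zA|_] := boolP (z \in A); last by rewrite mulr0 powR_ge0.
by rewrite mulr1; apply: ge0_ler_powR => //; rewrite ?nnegrE ?(ltW p0)//; apply: dA; exact: set_mem.
Qed.

(* Weighted arithmetic-geometric inequality:
   L * 1_A <= (L ^+ 2 / K + K * 1_A) / 2, where K = exp e bounds E_0 L ^+ 2. *)
Lemma joint_law_change n f (B : set mR) (q r : R) (A : set (n.-tuple (R * R))) :
  measurable B -> PX B = q%:E -> (forall x, f x = r * \1_B x) ->
  n%:R * q * (r ^+ 2 / sigma ^+ 2) <= 1 -> r ^+ 2 / sigma ^+ 2 <= 1 ->
  measurable A ->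
  (joint_law PX sigma f n A <=
   (1 / 2)%:E + (expR (expR 1) / 2)%:E * joint_law PX sigma (0%R : {mfun mR >-> R}) n A)%E.
Proof.
move=> mB PB fE nq1 u1 mA; pose K : R := expR (expR 1).
have K0 : 0 < K by exact: expR_gt0.
have q0 : 0 <= q by rewrite -lee_fin -PB.
have ml := @measurable_likelihood R sigma f.
have mIA : measurable_fun [set: n.-tuple (R * R)] (fun z => (\1_A z)%:E : \bar R).
  exact/measurable_EFinP/measurable_indic.
pose L := tuple_prod (n := n) (@likelihood R sigma f).
have mL : measurable_fun [set: n.-tuple (R * R)] L by exact: measurable_tuple_prod.
have l0 x : 0 <= likelihood sigma f x by exact: expR_ge0.
have IA0 z : (0 <= (\1_A z)%:E :> \bar R)%E by rewrite lee_fin.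
have P1A : (joint_law PX sigma f n A =
    \int[joint_law PX sigma (0%R : {mfun mR >-> R}) n]_z ((\1_A z)%:E * (L z)%:E))%E.
  transitivity (\int[joint_law PX sigma f n]_z (\1_A z)%:E)%E.
    by rewrite integral_indic// setIT.
  exact: (integral_iid_change ml l0 (@pair_law_likelihood R PX sigma sigma0 f) mIA IA0).
have L2E z : L z ^+ 2 = tuple_prod (fun x => likelihood sigma f x ^+ 2) z.
  by rewrite /L /tuple_prod prodrXl.
have mL2 : measurable_fun [set: n.-tuple (R * R)] (fun z => (L z ^+ 2)%:E).
  by apply/measurable_EFinP; exact: measurable_funX.
have L2 : (\int[joint_law PX sigma (0%R : {mfun mR >-> R}) n]_z (L z ^+ 2)%:E <= K%:E)%E.
  under eq_integral do rewrite L2E.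
  have ml2 : measurable_fun [set: R * R] (fun x => likelihood sigma f x ^+ 2).
    exact: measurable_funX.
  rewrite (integral_iid_prod n ml2 (fun x => sqr_ge0 _)
    (integral_likelihood_sq sigma0 mB PB fE)).
  by rewrite lee_fin mixture_expR_bound// divr_ge0// sqr_ge0.
have amgm z : ((\1_A z)%:E * (L z)%:E <=
    ((2 * K)^-1)%:E * (L z ^+ 2)%:E + (K / 2)%:E * (\1_A z)%:E)%E.
  rewrite -!EFinM -EFinD lee_fin indicE; case: (z \in A) => /=.
    rewrite mul1r mulr1 -subr_ge0.
    have -> : (2 * K)^-1 * L z ^+ 2 + K / 2 - L z = (L z - K) ^+ 2 / (2 * K).
      by field; rewrite gt_eqF.
    by rewrite divr_ge0 ?sqr_ge0// mulr_ge0// ltW.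
  by rewrite mul0r mulr0 addr0 mulr_ge0 ?sqr_ge0// invr_ge0 mulr_ge0// ltW.
apply: (le_trans (y := (\int[joint_law PX sigma (0%R : {mfun mR >-> R}) n]_z
    ((\1_A z)%:E * (L z)%:E))%E)); first by rewrite P1A.
apply: (@le_trans _ _ (\int[joint_law PX sigma (0%R : {mfun mR >-> R}) n]_z
    (((2 * K)^-1)%:E * (L z ^+ 2)%:E + (K / 2)%:E * (\1_A z)%:E))%E).
  apply: ge0_le_integral => //.
  - by move=> z _; rewrite mule_ge0// lee_fin tuple_prod_ge0.
  - by apply: emeasurable_funM => //; exact/measurable_EFinP.
  - by apply: emeasurable_funD; apply: emeasurable_funM.
have K20 : 0 <= (2 * K)^-1 by rewrite invr_ge0 mulr_ge0// ltW.
have K20' : 0 <= K / 2 by rewrite divr_ge0// ltW.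
have nn1 z : (0 <= ((2 * K)^-1)%:E * (L z ^+ 2)%:E)%E.
  by rewrite mule_ge0// lee_fin// sqr_ge0.
have nn2 z : (0 <= (K / 2)%:E * (\1_A z)%:E)%E by rewrite mule_ge0// lee_fin.
have m1 : measurable_fun [set: n.-tuple (R * R)] (fun z => ((2 * K)^-1)%:E * (L z ^+ 2)%:E)%E.
  exact: emeasurable_funM.
have m2 : measurable_fun [set: n.-tuple (R * R)] (fun z => (K / 2)%:E * (\1_A z)%:E)%E.
  exact: emeasurable_funM.
rewrite (ge0_integralD _ measurableT (fun z _ => nn1 z) m1 (fun z _ => nn2 z) m2).
rewrite !ge0_integralZl_EFin//; last by move=> z _; rewrite lee_fin sqr_ge0.
rewrite integral_indic// setIT leeD2r//.
apply: (@le_trans _ _ (((2 * K)^-1)%:E * K%:E)%E); first by rewrite lee_wpmul2l.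
by rewrite -EFinM lee_fin invfM -mulrA mulVf ?gt_eqF// mulr1 mul1r.
Qed.

(** The event [A] that [T] reaches [r / 2] tests one function against the other. If it has
    probability at least [1 / (2 * K)] under the zero function, it is an error there. Otherwise
    [joint_law_change] bounds its probability under [f] by 3/4, and its complement is an error under
    [f]. *)
Lemma two_point_lower_bound n (x0 p r q : R) (B : set mR) (f : {mfun mR >-> R})
    (S : set (R -> R)) : 0 < p -> 0 < r -> measurable B -> PX B = q%:E ->
  (forall x, f x = r * \1_B x) -> B x0 ->
  n%:R * q * (r ^+ 2 / sigma ^+ 2) <= 1 -> r ^+ 2 / sigma ^+ 2 <= 1 ->
  S f -> S (0%R : {mfun mR >-> R}) ->
  (((1 / (4 * expR (expR 1))) `^ p^-1 / 2 * r)%:E <= minimax_risk PX sigma p x0 n S)%E.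
Proof.
move=> p0 r0 mB PB fE Bx0 nq1 u1 Sf S0.
pose K : R := expR (expR 1).
have K1 : 1 <= K by rewrite -expR0 ler_expR expR_ge0.
have K0 : 0 < K by exact: expR_gt0.
(* [1 / (4 * K)] is at most [1 / (2 * K)] and at most [1 / 4], the error probabilities in the two
   cases. *)
pose v : R := (r / 2) `^ p * (1 / (4 * K)).
have v0 : 0 <= v by rewrite mulr_ge0 ?powR_ge0// divr_ge0// mulr_ge0// ltW.
have cE : (1 / (4 * K)) `^ p^-1 / 2 * r = v `^ p^-1.
  rewrite [RHS]powRM ?powR_ge0//; last by rewrite divr_ge0// mulr_ge0// ltW.
  rewrite -powRrM divff ?gt_eqF// powRr1 ?divr_ge0 ?(ltW r0)//.
  by rewrite mulrAC -mulrA mulrC.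
rewrite cE -poweR_EFin; apply: gt0_ler_poweR.
- by rewrite invr_ge0 ltW.
- by rewrite in_itv/= leey lee_fin v0.
(* The power is monotone on nonnegative values; the infimum is one, since the class contains [f]. *)
- rewrite in_itv/= leey andbT; apply: le_ereal_inf_tmp => _ [T _ <-].
  apply: (@le_trans _ _ (pointwise_risk PX sigma p x0 f T)); first exact: integral_ge0.
  by apply: ereal_sup_ubound; exists f.
apply: le_ereal_inf_tmp => _ [T _ <-].
pose A := [set z : n.-tuple (R * R) | r / 2 <= T z].
have mA : measurable A.
  have -> : A = [set: n.-tuple (R * R)] `&` T @^-1` `[r / 2, +oo[%classic.
    by apply/seteqP; split => z /=; rewrite in_itv/= andbT => //; case.
  have mT := measurable_funPT T.
  by apply: mT => //; exact: measurable_itv.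
have r20 : 0 <= r / 2 by rewrite divr_ge0// ltW.
pose P0 := joint_law PX sigma (0%R : {mfun mR >-> R}) n.
pose P1 := joint_law PX sigma f n.
have P1A := joint_law_change mB PB fE nq1 u1 mA.
have [a P0A] : exists a, P0 A = a%:E.
  by exists (fine (P0 A)); rewrite fineK// fin_num_measure.
have [b P1b] : exists b, P1 A = b%:E.
  by exists (fine (P1 A)); rewrite fineK// fin_num_measure.
have P1A' : (b%:E <= (1 / 2)%:E + (K / 2)%:E * a%:E)%E.
  by rewrite -P1b -P0A; exact: P1A.
have [aK|aK] := leP (1 / (2 * K)) a.
  have risk0 : (((r / 2) `^ p)%:E * P0 A <=
      pointwise_risk PX sigma p x0 (0%R : {mfun mR >-> R}) T)%E.
    apply: risk_markov => //.
    by move=> z /= Az; rewrite subr0 (le_trans Az)// ler_norm.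
  apply: (@le_trans _ _ (pointwise_risk PX sigma p x0 (0%R : {mfun mR >-> R}) T)); last first.
    by apply: ereal_sup_ubound; exists (0%R : {mfun mR >-> R}).
  apply: le_trans risk0; rewrite P0A /v -EFinM lee_fin ler_wpM2l ?powR_ge0//.
  apply: le_trans aK; rewrite ler_pM2l// lef_pV2 ?posrE ?mulr_gt0//.
  by rewrite ler_pM2r// ler_nat.
have mAC : measurable (~` A) by exact: measurableC.
have risk1 : (((r / 2) `^ p)%:E * P1 (~` A) <= pointwise_risk PX sigma p x0 f T)%E.
  apply: risk_markov => // z /= /negP; rewrite -ltNge => Az.
  rewrite fE indicE mem_set// mulr1 distrC ger0_norm; lra.
apply: (@le_trans _ _ (pointwise_risk PX sigma p x0 f T)); last first.
  by apply: ereal_sup_ubound; exists f.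
have P1AC : P1 (~` A) = (1 - b)%:E by rewrite probability_setC// P1b.
apply: le_trans risk1; rewrite P1AC /v -EFinM lee_fin ler_wpM2l ?powR_ge0//.
move: P1A'; rewrite -EFinM -EFinD lee_fin => bK.
have : K / 2 * a <= 1 / 4.
  have -> : 1 / 4 = K / 2 * (1 / (2 * K)) by field; rewrite gt_eqF.
  by rewrite ler_wpM2l ?divr_ge0 ?(ltW K0)// ltW.
have : 1 / (4 * K) <= 1 / 4.
  by rewrite ler_pM2l// lef_pV2 ?posrE ?mulr_gt0// ler_peMr.
move: bK; lra.
Qed.

End lower_bound.

(** * Upper bound *)

Section real_bounds.
Context {R : realType}.

(** Reduces moments of any positive order to the moment generating function. For [u] of modulus at
    least 1, the term of degree [N.+1 > p] of the exponential series dominates; otherwise the left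
    side is at most 1. *)
Lemma powR_le_expR (p : R) : 0 < p -> exists2 K : R, 0 < K &
  forall u : R, `|u| `^ p <= K * (expR u + expR (- u)).
Proof.
move=> p0; pose N := (Num.bound p).
have N1 : 1 <= (N.+1)`!%:R :> R by rewrite ler1n fact_gt0.
have N0 : 0 < (N.+1)`!%:R :> R by rewrite (lt_le_trans ltr01).
exists (N.+1)`!%:R => // u.
have eu : expR `|u| <= expR u + expR (- u).
  have [u0|/ltW u0] := leP 0 u.
    by rewrite ger0_norm// lerDl; exact: expR_ge0.
  by rewrite ler0_norm// lerDr; exact: expR_ge0.
apply: (@le_trans _ _ ((N.+1)`!%:R * expR `|u|)); last by rewrite ler_pM2l.
have u0 : 0 <= `|u| by exact: normr_ge0.
have [u1|u1] := lerP 1 `|u|.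
  apply: (@le_trans _ _ (`|u| `^ N.+1%:R)).
    by rewrite ler_powR// (le_trans (ltW (archi_boundP (ltW p0))))// ler_nat.
  rewrite powR_mulrn// mulrC -ler_pdivrMr//.
  by apply: le_trans (expR_ge1Dxn N u0); rewrite lerDr.
apply: (@le_trans _ _ (1 `^ p)).
  by rewrite ge0_ler_powR ?nnegrE// ltW.
by rewrite powR1 /= -[leLHS]mulr1 ler_pM// -expR0 ler_expR.
Qed.

(** The sum is at most three times its largest term, which also covers [p < 1], where convexity
    fails. *)
Lemma powRD3_le (p a b c : R) : 0 < p -> 0 <= a -> 0 <= b -> 0 <= c ->
  (a + b + c) `^ p <= 3 `^ p * (a `^ p + b `^ p + c `^ p).
Proof.
move=> p0 a0 b0 c0; pose M := Num.max a (Num.max b c).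
have M0 : 0 <= M by rewrite !le_max a0.
have [aM bM cM] : [/\ a <= M, b <= M & c <= M] by rewrite !le_max !lexx !orbT.
apply: (@le_trans _ _ ((3 * M) `^ p)).
  rewrite ge0_ler_powR ?nnegrE ?(ltW p0) ?mulr_ge0 ?addr_ge0//; lra.
rewrite powRM// ler_wpM2l ?powR_ge0//.
have [ap bp cp] : [/\ 0 <= a `^ p, 0 <= b `^ p & 0 <= c `^ p] by rewrite !powR_ge0.
have [->|[->|->]] : M = a \/ M = b \/ M = c.
  by rewrite /M; case: leP => _; [right; case: leP; [right|left]|left].
all: lra.
Qed.

(** Makes the exponential rate for windows with few points positive. *)
Lemma expRN1_lt : expR (- 1) < 1 / 2 :> R.
Proof.
rewrite expRN mul1r ltf_pV2 ?posrE ?expR_gt0//.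
by have := @expR_gt1Dx R 1 (oner_neq0 _); lra.
Qed.

End real_bounds.

(** * Truncated local average *)

Section local_average.
Context {R : realType}.
Local Notation mR := (measurableTypeR R).
Context (B : set mR) (mB : measurable B) (n : nat).
Implicit Types (f : {mfun mR >-> R}) (z : n.-tuple (R * R)).

Definition local_count z : R := \sum_(i < n) \1_B (tnth z i).1.

Definition local_sum z : R := \sum_(i < n) \1_B (tnth z i).1 * (tnth z i).2.

Definition local_noise f z : R :=
  \sum_(i < n) \1_B (tnth z i).1 * ((tnth z i).2 - f (tnth z i).1).

(* Truncating the denominator at m / 2, half the expected count, keeps the
   estimator bounded by noise and sup norm on the rare event of few points. *)
Definition local_average (m : R) z : R :=
  local_sum z / Num.max (local_count z) (m / 2).

Lemma measurable_tuple_sum (g : R * R -> R) : measurable_fun [set: R * R] g ->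
  measurable_fun [set: n.-tuple (R * R)] (fun z => \sum_(i < n) g (tnth z i)).
Proof.
move=> mg; apply: measurable_sum => i.
by apply: measurableT_comp => //; exact: measurable_tnth.
Qed.

Lemma measurable_indic_fst : measurable_fun [set: R * R] (fun x => \1_B x.1 : R).
Proof.
have mI : measurable_fun [set: mR] (\1_B : mR -> R) by exact: measurable_indic.
by apply: (measurableT_comp mI); exact: measurable_fst.
Qed.

Lemma measurable_local_count : measurable_fun [set: n.-tuple (R * R)] local_count.
Proof. exact: (@measurable_tuple_sum (fun x => \1_B x.1) measurable_indic_fst). Qed.

Lemma measurable_local_average (m : R) : 0 < m ->
  measurable_fun [set: n.-tuple (R * R)] (local_average m).
Proof.
move=> m0; apply: measurable_funM.
  apply: (@measurable_tuple_sum (fun x => \1_B x.1 * x.2)).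
  by apply: measurable_funM; [exact: measurable_indic_fst|exact: measurable_snd].
rewrite (_ : (fun z => _) = (fun z => (Num.max (local_count z) (m / 2)) `^ (- 1))); last first.
  by apply/funext => z; rewrite powR_inv1// le_max orbC divr_ge0// ltW.
apply: (measurableT_comp (measurable_powR (- 1))).
by apply: measurable_maxr => //; exact: measurable_local_count.
Qed.

Lemma measurable_local_noise f :
  measurable_fun [set: n.-tuple (R * R)] (local_noise f).
Proof.
apply: (@measurable_tuple_sum (fun x => \1_B x.1 * (x.2 - f x.1))).
apply: measurable_funM; first exact: measurable_indic_fst.
by apply: measurable_funB; [exact: measurable_snd|exact: measurable_comp_fst].
Qed.

Lemma local_count_ge0 z : 0 <= local_count z.
Proof. exact: sumr_ge0. Qed.

Lemma local_sum_noise f z : local_sum z =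
  local_noise f z + \sum_(i < n) \1_B (tnth z i).1 * f (tnth z i).1.
Proof.
by rewrite -big_split/=; apply: eq_bigr => i _; rewrite -mulrDr subrK.
Qed.

Lemma local_sum_bound (g : R -> R) (M : R) z : (forall x, B x -> `|g x| <= M) ->
  `|\sum_(i < n) \1_B (tnth z i).1 * g (tnth z i).1| <= local_count z * M.
Proof.
move=> gM; apply: (le_trans (ler_norm_sum _ _ _)).
rewrite mulr_suml; apply: ler_sum => i _.
rewrite indicE; have [iB|_] := boolP (_ \in B); last by rewrite !mul0r normr0.
by rewrite !mul1r; apply: gM; exact: set_mem.
Qed.

(** With at least [m / 2] points, the average of [f] is within [D] of [y] and the noise is divided
    by at least [m / 2]. With fewer, the sum of [f] over the points in [B] is at most [m / 2 * a] in
    modulus, so its share of the estimate is at most [a], as is the modulus of [y]. *)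
Lemma local_average_error f (m D a y : R) z : 0 < m -> 0 <= D -> 0 <= a ->
  `|y| <= a -> (forall x, B x -> `|f x| <= a) ->
  (forall x, B x -> `|f x - y| <= D) ->
  `|local_average m z - y| <=
  D + 2 / m * `|local_noise f z| + (if local_count z < m / 2 then 2 * a else 0).
Proof.
move=> m0 D0 a0 ya fa fD; have m20 : 0 < m / 2 by rewrite divr_gt0.
have := local_count_ge0 z; rewrite /local_average (local_sum_noise f).
set N := local_count z; set Z := local_noise f z => N0.
have [Nm|mN] := ltP N (m / 2).
  have := local_sum_bound z fa; set S := \sum_(i < n) _ => Sa.
  have Sa' : `|S| <= m / 2 * a by rewrite (le_trans Sa)// ler_wpM2r// ltW.
  apply: (le_trans (ler_normB _ _)).
  have : `|(Z + S) / (m / 2)| <= 2 / m * `|Z| + a.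
    rewrite normrM normfV (gtr0_norm m20) ler_pdivrMr//.
    have -> : (2 / m * `|Z| + a) * (m / 2) = `|Z| + m / 2 * a.
      by field; rewrite gt_eqF.
    by apply: (le_trans (ler_normD _ _)); rewrite lerD2l.
  lra.
rewrite addr0; have N1 : 0 < N by exact: lt_le_trans mN.
have -> : (Z + \sum_(i < n) \1_B (tnth z i).1 * f (tnth z i).1) / N - y =
    (\sum_(i < n) \1_B (tnth z i).1 * (f (tnth z i).1 - y)) / N + Z / N.
  have -> : \sum_(i < n) \1_B (tnth z i).1 * (f (tnth z i).1 - y) =
      \sum_(i < n) \1_B (tnth z i).1 * f (tnth z i).1 - N * y.
    by rewrite /N mulr_suml -sumrB; apply: eq_bigr => i _; rewrite mulrBr.
  by field; rewrite gt_eqF.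
have le1 := @local_sum_bound (fun x => f x - y) D z fD.
apply: (le_trans (ler_normD _ _)); apply: lerD.
  by rewrite normrM normfV (gtr0_norm N1) ler_pdivrMr// mulrC.
rewrite normrM normfV (gtr0_norm N1) mulrC ler_wpM2r//.
by rewrite -[2 / m]invf_div lef_pV2 ?posrE.
Qed.

End local_average.

(** * Generating functions and risk of the local average *)

Section moments.
Context {R : realType}.
Local Notation mR := (measurableTypeR R).
Context (PX : probability mR R) (sigma : R) (sigma0 : 0 < sigma).
Context (B : set mR) (mB : measurable B) (q : R) (PB : PX B = q%:E).
Implicit Types (f : {mfun mR >-> R}).

Lemma expR_tuple_sum n (t : R) (g : R * R -> R) (z : n.-tuple (R * R)) :
  expR (t * \sum_(i < n) g (tnth z i)) = tuple_prod (fun x => expR (t * g x)) z.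
Proof. by rewrite mulr_sumr expR_sum. Qed.

Lemma local_noise_mgf n f (t : R) :
  (\int[joint_law PX sigma f n]_z (expR (t * local_noise B f z))%:E =
   ((1 + q * (expR (t ^+ 2 * sigma ^+ 2 / 2) - 1)) ^+ n)%:E)%E.
Proof.
pose g (x : R * R) : R := \1_B x.1 * (x.2 - f x.1).
have mg : measurable_fun [set: R * R] g.
  apply: measurable_funM; first exact: measurable_indic_fst.
  by apply: measurable_funB; [exact: measurable_snd|exact: measurable_comp_fst].
have ml : measurable_fun [set: R * R] (fun x => expR (t * g x)).
  by apply: measurableT_comp => //; exact: measurable_funM.
rewrite -(@integral_iid_prod _ _ _ (pair_law PX sigma f) _ _ n ml (fun x => expR_ge0 _)).
  by apply: eq_integral => z _; rewrite -expR_tuple_sum.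
have mlE : measurable_fun [set: R * R] (fun x => (expR (t * g x))%:E).
  exact/measurable_EFinP.
have l0 x : (0 <= (expR (t * g x))%:E)%E by rewrite lee_fin expR_ge0.
rewrite [LHS](ge0_integral_pair_law PX sigma f mlE l0).
rewrite -(integral_mixture mB PB (expR_ge0 _)); apply: eq_integral => x _.
transitivity (\int[normal_prob 0 sigma]_(e in [set: mR]) (expR ((t * \1_B x) * e))%:E)%E.
  by apply: eq_integral => e _; rewrite /g /= (addrC (f x)) addrK mulrA.
rewrite normal_mgf// indicE; case: (x \in B) => /=; first by rewrite mulr1.
by rewrite mulr0 expr0n/= !mul0r expR0.
Qed.

(** Serves at [t = -1] in a Chernoff bound for having too few points. *)
Lemma local_count_mgf n f (t : R) :
  (\int[joint_law PX sigma f n]_z (expR (t * local_count B z))%:E =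
   ((1 + q * (expR t - 1)) ^+ n)%:E)%E.
Proof.
pose g (x : R * R) : R := \1_B x.1.
have mg : measurable_fun [set: R * R] g by exact: measurable_indic_fst.
have ml : measurable_fun [set: R * R] (fun x => expR (t * g x)).
  by apply: measurableT_comp => //; exact: measurable_funM.
rewrite -(@integral_iid_prod _ _ _ (pair_law PX sigma f) _ _ n ml (fun x => expR_ge0 _)).
  by apply: eq_integral => z _; rewrite -expR_tuple_sum.
have mlE : measurable_fun [set: R * R] (fun x => (expR (t * g x))%:E).
  exact/measurable_EFinP.
have l0 x : (0 <= (expR (t * g x))%:E)%E by rewrite lee_fin expR_ge0.
rewrite [LHS](ge0_integral_pair_law PX sigma f mlE l0).
rewrite -(integral_mixture mB PB (expR_ge0 _)); apply: eq_integral => x _.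
transitivity (\int[normal_prob 0 sigma]_(e in [set: mR]) cst (expR (t * \1_B x))%:E e)%E.
  by [].
rewrite integral_cst//= [X in (_ * X)%E](_ : _ = 1%E); last exact: probability_setT.
by rewrite mule1 /g /= indicE; case: (x \in B); rewrite /= ?mulr1 ?mulr0 ?expR0.
Qed.

(** Each of the three error terms, raised to the power [p], is bounded by a constant or by
    exponentials of known mean. The choice [t = r / sigma ^+ 2] turns the noise coefficient [2 / m]
    into [2 * r * t] and keeps the generating functions at [t] and [- t] at most [expR (expR 1)]. *)
Lemma local_average_risk n f (x0 p D a r K : R) (T : {mfun n.-tuple (R * R) >-> R}) :
  0 < p -> 0 <= D -> 0 <= a -> 0 < r -> r ^+ 2 / sigma ^+ 2 <= 1 ->
  n%:R * q * (r ^+ 2 / sigma ^+ 2) = 1 -> 0 < K ->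
  (forall u : R, `|u| `^ p <= K * (expR u + expR (- u))) ->
  `|f x0| <= a -> (forall x, B x -> `|f x| <= a) ->
  (forall x, B x -> `|f x - f x0| <= D) ->
  (forall z, T z = local_average B (n%:R * q) z) ->
  (pointwise_risk PX sigma p x0 f T <=
   (3 `^ p * (D `^ p + (2 * r) `^ p * (K * (2 * expR (expR 1))) +
    (2 * a) `^ p * expR (- ((1 / 2 - expR (- 1)) * (n%:R * q)))))%:E)%E.
Proof.
move=> p0 D0 a0 r0 u1 nqu K0 Kp fx0 fa fD TE.
pose m := n%:R * q; pose t := r / sigma ^+ 2.
have s20 : 0 < sigma ^+ 2 by rewrite exprn_gt0.
have u0 : 0 < r ^+ 2 / sigma ^+ 2 by rewrite divr_gt0 ?exprn_gt0.
have m0 : 0 < m by rewrite -(pmulr_lgt0 _ u0) nqu.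
have t0 : 0 < t by rewrite divr_gt0.
have mE : 2 / m = 2 * r * t.
  have -> : 2 * r * t = 2 / m * (m * (r ^+ 2 / sigma ^+ 2)).
    by rewrite /t; field; rewrite !gt_eqF.
  by rewrite nqu mulr1.
have q0 : 0 <= q by rewrite -lee_fin -PB.
have q1 : q <= 1 by rewrite -lee_fin -PB; exact: probability_le1.
pose E1 (z : n.-tuple (R * R)) := expR (t * local_noise B f z).
pose E2 (z : n.-tuple (R * R)) := expR (- t * local_noise B f z).
pose E3 (z : n.-tuple (R * R)) := expR (- 1 * local_count B z).
pose c0 := 3 `^ p * D `^ p.
pose c1 := 3 `^ p * ((2 * r) `^ p * K).
pose c3 := 3 `^ p * ((2 * a) `^ p * expR (m / 2)).
have c0_ge0 : 0 <= c0 by rewrite mulr_ge0 ?powR_ge0.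
have c1_ge0 : 0 <= c1 by rewrite !mulr_ge0 ?powR_ge0// ltW.
have c3_ge0 : 0 <= c3 by rewrite !mulr_ge0 ?powR_ge0 ?expR_ge0.
have pw z : `|T z - f x0| `^ p <= c0 + c1 * E1 z + c1 * E2 z + c3 * E3 z.
  have := local_average_error z m0 D0 a0 fx0 fa fD; rewrite -TE mE.
  set Z := local_noise B f z; set N := local_count B z => err.
  have tZ : 2 * r * t * `|Z| = 2 * r * `|t * Z|.
    by rewrite (normrM t) (gtr0_norm t0) !mulrA.
  rewrite tZ in err.
  have b0 : 0 <= 2 * r * `|t * Z| by rewrite mulr_ge0// mulr_ge0// ltW.
  have bp : (2 * r * `|t * Z|) `^ p <= (2 * r) `^ p * (K * (E1 z + E2 z)).
    rewrite powRM ?normr_ge0// ?mulr_ge0 ?(ltW r0)//.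
    by rewrite ler_wpM2l ?powR_ge0// /E2 mulNr.
  have i0 : 0 <= (if N < m / 2 then 2 * a else 0) by case: ifP => // _; rewrite mulr_ge0.
  (* If [N < m / 2] then [1 <= expR (m / 2 - N)]; otherwise the left side is a positive power of
     0. *)
  have ip : (if N < m / 2 then 2 * a else 0) `^ p <= (2 * a) `^ p * (expR (m / 2) * E3 z).
    case: ifPn => [Nm|_].
      by rewrite ler_peMr ?powR_ge0// /E3 mulN1r -expRD -[leLHS]expR0 ler_expR subr_ge0 ltW.
    by rewrite powR0 ?gt_eqF// !mulr_ge0 ?powR_ge0 ?expR_ge0.
  apply: (@le_trans _ _ ((D + 2 * r * `|t * Z| + (if N < m / 2 then 2 * a else 0)) `^ p)).
    by rewrite ge0_ler_powR ?nnegrE ?(ltW p0)// !addr_ge0.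
  apply: (le_trans (powRD3_le p0 D0 b0 i0)).
  rewrite (_ : c0 + c1 * E1 z + c1 * E2 z + c3 * E3 z = 3 `^ p *
    (D `^ p + (2 * r) `^ p * (K * (E1 z + E2 z)) + (2 * a) `^ p * (expR (m / 2) * E3 z))).
    by rewrite ler_wpM2l ?powR_ge0// lerD// lerD2l.
  by rewrite /c0 /c1 /c3; ring.
have mE1 : measurable_fun [set: n.-tuple (R * R)] (fun z => (E1 z)%:E).
  apply/measurable_EFinP; apply: measurableT_comp => //; apply: measurable_funM => //.
  exact: measurable_local_noise.
have mE2 : measurable_fun [set: n.-tuple (R * R)] (fun z => (E2 z)%:E).
  apply/measurable_EFinP; apply: measurableT_comp => //; apply: measurable_funM => //.
  exact: measurable_local_noise.
have mE3 : measurable_fun [set: n.-tuple (R * R)] (fun z => (E3 z)%:E).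
  apply/measurable_EFinP; apply: measurableT_comp => //; apply: measurable_funM => //.
  exact: measurable_local_count.
have uE : t ^+ 2 * sigma ^+ 2 / 2 = r ^+ 2 / sigma ^+ 2 / 2.
  by rewrite /t; field; rewrite gt_eqF.
have [u20 u21] : 0 <= r ^+ 2 / sigma ^+ 2 / 2 /\ r ^+ 2 / sigma ^+ 2 / 2 <= 1 by lra.
have nqu2 : n%:R * q * (r ^+ 2 / sigma ^+ 2 / 2) <= 1 by rewrite mulrA nqu; lra.
have I1 : (\int[joint_law PX sigma f n]_z (E1 z)%:E <= (expR (expR 1))%:E)%E.
  rewrite local_noise_mgf uE lee_fin mixture_expR_bound// ?nqu2//.
have I2 : (\int[joint_law PX sigma f n]_z (E2 z)%:E <= (expR (expR 1))%:E)%E.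
  rewrite local_noise_mgf sqrrN uE lee_fin mixture_expR_bound// ?nqu2//.
(* Together with the factor [expR (m / 2)] in [c3] this leaves the exponent
   [- (1 / 2 - expR (- 1)) * m]. *)
have I3 : (\int[joint_law PX sigma f n]_z (E3 z)%:E <=
    (expR (- ((1 - expR (- 1)) * m)))%:E)%E.
  rewrite local_count_mgf lee_fin.
  apply: (@le_trans _ _ (expR (q * (expR (- 1) - 1)) ^+ n)).
    rewrite lerXn2r ?nnegrE ?expR_ge0 ?expR_ge1Dx//.
    have -> : 1 + q * (expR (- 1) - 1) = (1 - q) + q * expR (- 1) by ring.
    by rewrite addr_ge0 ?subr_ge0// mulr_ge0// expR_ge0.
  by rewrite -expRM_natl ler_expR le_eqVlt; apply/orP; left; apply/eqP; rewrite /m; ring.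
have nE1 z : (0 <= c1%:E * (E1 z)%:E)%E by rewrite mule_ge0// lee_fin expR_ge0.
have nE2 z : (0 <= c1%:E * (E2 z)%:E)%E by rewrite mule_ge0// lee_fin expR_ge0.
have nE3 z : (0 <= c3%:E * (E3 z)%:E)%E by rewrite mule_ge0// lee_fin expR_ge0.
have m1 : measurable_fun [set: n.-tuple (R * R)]
    (fun z => c1%:E * (E1 z)%:E)%E.
  by exact: emeasurable_funM.
have m2 : measurable_fun [set: n.-tuple (R * R)]
    (fun z => c1%:E * (E2 z)%:E)%E.
  by exact: emeasurable_funM.
have m3 : measurable_fun [set: n.-tuple (R * R)]
    (fun z => c3%:E * (E3 z)%:E)%E.
  by exact: emeasurable_funM.
have m01 : measurable_fun [set: n.-tuple (R * R)]
    (fun z => c0%:E + c1%:E * (E1 z)%:E)%E.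
  by exact: emeasurable_funD.
have m012 : measurable_fun [set: n.-tuple (R * R)]
    (fun z => c0%:E + c1%:E * (E1 z)%:E + c1%:E * (E2 z)%:E)%E.
  by exact: emeasurable_funD.
have n01 z : (0 <= c0%:E + c1%:E * (E1 z)%:E)%E by rewrite adde_ge0.
have n012 z : (0 <= c0%:E + c1%:E * (E1 z)%:E + c1%:E * (E2 z)%:E)%E by rewrite adde_ge0.
rewrite /pointwise_risk.
apply: (@le_trans _ _ (\int[joint_law PX sigma f n]_z
    (c0%:E + c1%:E * (E1 z)%:E + c1%:E * (E2 z)%:E + c3%:E * (E3 z)%:E))%E).
  apply: ge0_le_integral => //.
  - exact: measurable_loss.
  - exact: emeasurable_funD m012 m3.
  - by move=> z _; rewrite -!EFinM -!EFinD lee_fin pw.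
rewrite (ge0_integralD _ measurableT (fun z _ => n012 z) m012 (fun z _ => nE3 z) m3).
rewrite (ge0_integralD _ measurableT (fun z _ => n01 z) m01 (fun z _ => nE2 z) m2).
rewrite (ge0_integralD _ measurableT (fun z _ => c0_ge0 : (0 <= c0%:E)%E)
  (measurable_cst _) (fun z _ => nE1 z) m1).
rewrite integral_cst// [X in (_ * X)%E](_ : _ = 1%E) ?mule1; last exact: probability_setT.
rewrite !ge0_integralZl_EFin//; do ?by move=> z _; rewrite lee_fin expR_ge0.
apply: (@le_trans _ _ (c0%:E + c1%:E * (expR (expR 1))%:E + c1%:E * (expR (expR 1))%:E +
    c3%:E * (expR (- ((1 - expR (- 1)) * m)))%:E)%E).
  by apply: leeD; [apply: leeD; [apply: leeD => //|]|]; apply: lee_wpmul2l.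
rewrite -!EFinM -!EFinD lee_fin le_eqVlt; apply/orP; left; apply/eqP.
have -> : - ((1 / 2 - expR (- 1)) * (n%:R * q)) = m / 2 + - ((1 - expR (- 1)) * m).
  by rewrite /m; field.
by rewrite expRD /c0 /c1 /c3; ring.
Qed.

End moments.

(** * Minimax risk *)

Section symmetric_density.
Context {R : realType}.
Local Notation mR := (measurableTypeR R).
Local Notation leb := (@lebesgue_measure R).
Local Open Scope ereal_scope.

Lemma ge0_integral_opp (f : mR -> \bar R) :
  measurable_fun [set: mR] f -> (forall x, 0 <= f x) ->
  \int[leb]_x f (- x)%R = \int[leb]_x f x.
Proof.
move=> mf f0.
have mN : measurable_fun [set: mR] (fun x : mR => (- x)%R : mR) by exact: oppr_measurable.
have := @ge0_integral_pushforward _ _ _ _ _ _ mN leb setT f measurableT mf (fun x _ => f0 x).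
rewrite preimage_setT => <-.
apply: eq_measure_integral => A mA _; exact: lebesgue_measureN.
Qed.

(* Intersecting with [0, 1] costs no probability and spares a proof that x0 is
   interior: members of the class are controlled on [0, 1] only. *)
Definition window (x0 h : R) : set mR := [set x | (0 <= x <= 1)%R /\ (`|x - x0| <= h)%R].

Lemma window_itv (x0 h : R) :
  window x0 h = `[(x0 - h)%R, (x0 + h)%R]%classic `&` `[0%R, 1%R]%classic.
Proof.
rewrite /window; apply/seteqP; split => x /=; rewrite !in_itv/= ler_distl.
  by move=> [-> ->].
by move=> [-> ->].
Qed.

Lemma measurable_window (x0 h : R) : measurable (window x0 h).
Proof. by rewrite window_itv; apply: measurableI; exact: measurable_itv. Qed.

Context (nu : R -> R) (nu_pos : pos_continuous nu)
  (nu_nd : forall a b : R, (0 < a)%R -> (a <= b)%R -> (nu a <= nu b)%R).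

Lemma mass_EFin (h : R) : \int[leb]_(t in `]0%R, h]) (nu t)%:E = (mass nu h)%:E.
Proof.
rewrite /mass /Rintegral fineK//; apply: integrable_fin_num => //.
exact: (mass_integrable nu_pos nu_nd).
Qed.

(** Points outside [0, 1] carry no probability. After translation by [x0] the integrand is even, and
    each half contributes one mass. *)
Lemma has_density_window (PX : probability mR R) (mu : mR -> R) (x0 d h : R) :
  has_density PX mu -> PX [set x | (0 <= x <= 1)%R] = 1 ->
  (forall x, x != x0 -> (`|x - x0| < d)%R -> mu x = nu `|x - x0|%R) ->
  (0 < h)%R -> (h < d)%R -> PX (window x0 h) = (2 * mass nu h)%:E.
Proof.
move=> [mmu mu0 PXE] PX1 munu h0 hd.
pose C : set mR := `[(x0 - h)%R, (x0 + h)%R]%classic.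
pose I : set mR := `[0%R, 1%R]%classic.
have mC : measurable C by exact: measurable_itv.
have mI : measurable I by exact: measurable_itv.
have PI : PX I = 1.
  rewrite -PX1; congr (PX _); apply/seteqP; split => x /=; rewrite in_itv//.
have -> : PX (window x0 h) = PX C.
  rewrite window_itv -/C -/I (measureDI PX mC mI) [X in _ = X + _](_ : _ = 0) ?add0e//.
  apply/eqP; rewrite -measure_le0; apply: (@le_trans _ _ (PX (~` I))).
    by apply: le_measure; rewrite ?inE; [exact: measurableD|exact: measurableC|move=> x []].
  by rewrite probability_setC// PI subee.
have mC' : measurable (C `\ x0) by apply: measurableD.
have mEmu : measurable_fun [set: mR] (EFin \o mu) by exact/measurable_EFinP.
(* The centre, a null set, is removed because [mu] is prescribed only off [x0]. *)
rewrite PXE// -(@integral_setD1 _ _ x0)//; last exact: measurable_funTS.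
rewrite integral_mkcond.
have mF : measurable_fun [set: mR] ((EFin \o mu) \_ (C `\ x0)).
  by apply/(measurable_restrictT _ _).1 => //; exact: measurable_funTS.
have F0 x : 0 <= ((EFin \o mu) \_ (C `\ x0)) x.
  by rewrite patchE; case: ifP => // _; rewrite lee_fin.
rewrite -(ge0_integral_shift x0 mF F0).
pose G := (EFin \o nu) \_ `]0%R, h].
have mG : measurable_fun [set: mR] G.
  apply/(measurable_restrictT _ _).1 => //.
  by apply/measurable_EFinP; exact: (mass_measurable nu_pos).
have G0 x : 0 <= G x.
  rewrite /G patchE; case: ifP => // /set_mem /=; rewrite in_itv/= => /andP[x_gt0 _].
  by rewrite lee_fin ltW//; have [] := nu_pos x_gt0.
have -> : (2 * mass nu h)%:E = \int[leb]_x G x + \int[leb]_x G x.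
  by rewrite -integral_mkcond mass_EFin -EFinD; congr (_%:E); ring.
rewrite -[in X in _ = X + _](ge0_integral_opp mG G0) -ge0_integralD//; last first.
  by apply: (measurableT_comp mG); exact: oppr_measurable.
apply: eq_integral => x _; rewrite /G !patchE /=.
have inJ y : (y \in (`]0%R, h]%classic : set R)) = ((0 < y) && (y <= h))%R.
  by apply/idP/idP; rewrite inE/= in_itv.
have inC : ((x0 + x)%R \in C `\ x0) = ((`|x| <= h) && (x != 0))%R.
  apply/idP/idP.
    rewrite inE /C /= in_itv/= => -[/andP[l u] ne]; apply/andP; split.
      by rewrite ler_norml; apply/andP; split; lra.
    by apply/eqP => x00; apply: ne; rewrite x00 addr0.
  rewrite ler_norml => /andP[/andP[l u] ne]; rewrite inE /C /= in_itv/=; split.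
    by apply/andP; split; lra.
  by move=> /eqP; rewrite -subr_eq0 addrC addrA (addrC (- _)%R) subrr add0r; apply/negP.
rewrite inC !inJ.
have muE : x != 0%R -> (`|x| <= h)%R -> mu (x0 + x)%R = nu `|x|%R.
  move=> xn0 xh; have e : (x0 + x - x0 = x)%R by rewrite addrC addKr.
  rewrite munu ?e//; last exact: le_lt_trans hd.
  by rewrite -subr_eq0 e.
(* Restrictions take the default value [point] outside their domain, which is 0 here. *)
have point0 : point = 0 :> \bar R by [].
rewrite !point0; have [x_lt0|x_gt0|->] := ltgtP x 0%R.
- rewrite oppr_gt0 x_lt0 andbT -(ltr0_norm x_lt0) /= adde0.
  by case: ifPn => // xh; rewrite muE// lt_eqF.
- rewrite andbT oppr_gt0 (ltNge x) (ltW x_gt0) /= add0e.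
  case: ifPn => xh; first by move: (xh); rewrite muE ?gt_eqF// gtr0_norm// => ->.
  by move: xh; rewrite gtr0_norm// => /negbTE ->.
- by rewrite andbF oppr0 ltxx /= adde0.
Qed.

End symmetric_density.

Section tail.
Context {R : realType}.

Lemma expR_beats_powR (p gamma A kappa sigma : R) :
  0 < p -> 0 < gamma -> 0 < A -> 0 < kappa -> 0 < sigma ->
  exists2 d : R, 0 < d & forall r, 0 < r -> r < d ->
    (A * r `^ (- gamma)) `^ p * expR (- (kappa * (sigma ^+ 2 / r ^+ 2))) <= r `^ p.
Proof.
move=> p0 g0 A0 k0 s0; pose N := Num.bound ((gamma + 1) * p + 1).
have g1p : 0 <= (gamma + 1) * p + 1 by rewrite addr_ge0// mulr_ge0 ?(ltW p0)// addr_ge0// ltW.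
have NP : (gamma + 1) * p + 1 <= N%:R by exact/ltW/archi_boundP.
pose c := (kappa * sigma ^+ 2) ^+ N.+1.
have c0 : 0 < c by rewrite exprn_gt0// mulr_gt0// exprn_gt0.
have F0 : 0 < (N.+1)`!%:R :> R by rewrite ltr0n fact_gt0.
pose M := A `^ p * ((N.+1)`!%:R / c).
have M0 : 0 < M by rewrite mulr_gt0 ?powR_gt0// divr_gt0.
exists (Num.min 1 M^-1); first by rewrite lt_min ltr01 invr_gt0.
move=> r r0; rewrite lt_min => /andP[r1 rM].
set x := kappa * _.
have x0 : 0 <= x by rewrite mulr_ge0 ?(ltW k0)// divr_ge0 ?exprn_ge0 ?ltW.
have alg (a b y z : R) : 0 < a -> 0 < b -> a / b * y * (z / a) = z * y / b.
  by move=> a_gt0 b_gt0; field; rewrite !gt_eqF.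
have ex : expR (- x) <= (N.+1)`!%:R / c * r `^ (2 * N.+1%:R).
  rewrite expRN -[leLHS]div1r ler_pdivrMr ?expR_gt0//.
  apply: (@le_trans _ _ ((N.+1)`!%:R / c * r `^ (2 * N.+1%:R) * (x ^+ N.+1 / (N.+1)`!%:R))).
    rewrite powRrM powR_mulrn ?powR_ge0// (powR_mulrn 2) ?(ltW r0)//.
    have -> : (N.+1)`!%:R / c * (r ^+ 2) ^+ N.+1 * (x ^+ N.+1 / (N.+1)`!%:R) =
        (x * r ^+ 2) ^+ N.+1 / c.
      by rewrite alg// [in RHS](exprMn _ x).
    have -> : x * r ^+ 2 = kappa * sigma ^+ 2 by rewrite /x; field; rewrite gt_eqF.
    by rewrite divff// gt_eqF.
  rewrite ler_wpM2l ?mulr_ge0 ?powR_ge0 ?invr_ge0 ?(ltW c0)//.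
  by apply: le_trans (expR_ge1Dxn N x0); rewrite lerDr.
apply: (@le_trans _ _ (M * r `^ (p + 1))).
  apply: (@le_trans _ _ ((A * r `^ (- gamma)) `^ p *
      ((N.+1)`!%:R / c * r `^ (2 * N.+1%:R)))).
    by rewrite ler_wpM2l ?powR_ge0.
  rewrite powRM ?powR_ge0 ?(ltW A0)// -powRrM mulrACA -/M ler_wpM2l ?(ltW M0)//.
  rewrite -powRD; last by rewrite (gt_eqF r0) implybT.
  apply: ger_powR; first by rewrite r0 ltW.
  have : (N%:R : R) <= N.+1%:R by rewrite ler_nat.
  have : (0 : R) <= N.+1%:R by exact: ler0n.
  move: NP; rewrite mulrDl mul1r mulNr; lra.
rewrite powRD; last by rewrite (gt_eqF r0) implybT.
rewrite powRr1 ?(ltW r0)// mulrCA ler_piMr ?powR_ge0//.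
by rewrite mulrC -ler_pdivlMr// mul1r ltW.
Qed.

End tail.

(** * Membership in the function class *)

Section classes.
Context {R : realType}.
Local Notation mR := (measurableTypeR R).
Context (s : R) (s01 : 0 < s <= 1) (omega : R -> R)
  (omega_pos : forall h, 0 < h -> 0 < omega h).

Lemma lower_degree0 : lower_degree s = 0%N.
Proof.
rewrite /lower_degree; have /andP[s0 s1] := s01.
suff -> : Num.ceil s = 1 by [].
by apply: ceil_def; rewrite /= subrr s0 s1.
Qed.

(** The infimum lies strictly below [2 * omega h], so some constant is that close to [f] on the
    whole window; [x] and [x0] both lie there, and the triangle inequality doubles the bound. *)
Lemma F_class_oscillation (f : R -> R) (x0 h : R) : 0 <= x0 <= 1 -> 0 < h ->
  F_class s h x0 omega f -> forall x, window x0 h x -> `|f x - f x0| <= 4 * omega h.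
Proof.
move=> x01 h0 /(_ h h0 (lexx h)) inf_le x xB; have oh := omega_pos h0.
have : (ereal_inf [set poly_dev f x0 h P | P in [set P : {poly R} |
    (size P <= (lower_degree s).+1)%N]] < (2 * omega h)%:E)%E.
  by apply: (le_lt_trans inf_le); rewrite lte_fin; lra.
move=> /ereal_inf_lt[_ [P /= sP <-]] PB.
have dev y : window x0 h y -> `|f y - P.[y - x0]| < 2 * omega h.
  move=> [y01 yh]; rewrite -lte_fin; apply: le_lt_trans PB.
  by apply: ereal_sup_ubound; exists y.
have x0B : window x0 h x0 by split; rewrite // subrr normr0 ltW.
have PC : P = (P`_0)%:P by apply: size1_polyC; rewrite -lower_degree0.
have := dev _ xB; have := dev _ x0B; rewrite PC !hornerC.
set c := P`_0 => d0 dx.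
have -> : f x - f x0 = (f x - c) - (f x0 - c) by ring.
by apply: (le_trans (ler_normB _ _)); lra.
Qed.

(** The constant [c] has zero deviation. Only radii up to [h] are constrained, so [f] may jump at
    the edge of the window. *)
Lemma F_class_window (f : R -> R) (x0 h c : R) :
  (forall x, window x0 h x -> f x = c) -> F_class s h x0 omega f.
Proof.
move=> fc h' h'0 h'h; apply: (@le_trans _ _ (poly_dev f x0 h' c%:P)).
  by apply: ereal_inf_lbound; exists c%:P => //=; rewrite size_polyC (leq_trans (leq_b1 _)).
apply: ge_ereal_sup => _ [x [x01 xh] <-].
rewrite hornerC fc; last by split => //; exact: le_trans h'h.
by rewrite subrr normr0 lee_fin ltW// omega_pos.
Qed.

End classes.

Section minimax.
Context {R : realType}.
Local Notation mR := (measurableTypeR R).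
Context (s : R) (s01 : 0 < s <= 1) (omega : R -> R)
  (omega_pos : forall h, 0 < h -> 0 < omega h).
Context (PX : probability mR R) (sigma : R) (sigma0 : 0 < sigma).
Context (p : R) (p0 : 0 < p) (n : nat) (x0 h q alpha : R).
Context (x01 : 0 <= x0 <= 1) (h0 : 0 < h) (PB : PX (window x0 h) = q%:E).
Context (nq : n%:R * q * (omega h ^+ 2 / sigma ^+ 2) = 1)
  (u1 : omega h ^+ 2 / sigma ^+ 2 <= 1).

Let center_window : window x0 h x0.
Proof. by split; rewrite // subrr normr0 ltW. Qed.

(** The two points are [f1] and the zero function; the assumption on [alpha] keeps [f1] within the
    sup-norm bound. *)
Lemma minimax_risk_ge : omega h <= alpha ->
  (((1 / (4 * expR (expR 1))) `^ p^-1 / 2 * omega h)%:E <=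
   minimax_risk PX sigma p x0 n (Sigma_class s h alpha x0 omega))%E.
Proof.
move=> ralpha; have r0 := omega_pos h0.
have alpha0 := le_trans (ltW r0) ralpha.
have mB := measurable_window x0 h.
have mf1 : measurable_fun [set: mR] (fun x : mR => omega h * \1_(window x0 h) x).
  by apply: measurable_funM => //; exact: measurable_indic.
pose mix := isMeasurableFun.Build _ _ _ _ _ mf1.
pose f1 : {mfun mR >-> R} := HB.pack (fun x : mR => omega h * \1_(window x0 h) x) mix.
apply: (@two_point_lower_bound _ PX sigma sigma0 n x0 p (omega h) q _ f1 _
  p0 r0 mB PB (fun=> erefl) center_window _ u1).
- by rewrite nq.
- split.
    apply: (F_class_window s omega_pos (c := omega h)) => x xB.
    by rewrite /= indicE mem_set// mulr1.
  move=> x _; rewrite /= indicE normrM (gtr0_norm r0).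
  by case: (x \in _); rewrite /= ?normr1 ?normr0 ?mulr1 ?mulr0.
- split; first exact: (F_class_window s omega_pos (c := 0)).
  by move=> x _; rewrite /= normr0.
Qed.

(** Bias, noise and, through the last assumption, the event of few points each contribute a multiple
    of [omega h] to the power [p]. *)
Lemma minimax_risk_le (K : R) : 0 <= alpha -> 0 < K ->
  (forall u : R, `|u| `^ p <= K * (expR u + expR (- u))) ->
  (2 * alpha) `^ p * expR (- ((1 / 2 - expR (- 1)) * (sigma ^+ 2 / omega h ^+ 2))) <=
    omega h `^ p ->
  (minimax_risk PX sigma p x0 n (Sigma_class s h alpha x0 omega) <=
   ((3 `^ p * (4 `^ p + 2 `^ p * (K * (2 * expR (expR 1))) + 1)) `^ p^-1 * omega h)%:E)%E.
Proof.
move=> alpha0 K0 KP tail; have r0 := omega_pos h0.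
have mB := measurable_window x0 h.
have mE : n%:R * q = sigma ^+ 2 / omega h ^+ 2.
  have -> : sigma ^+ 2 / omega h ^+ 2 =
      n%:R * q * (omega h ^+ 2 / sigma ^+ 2) * (sigma ^+ 2 / omega h ^+ 2).
    by rewrite nq mul1r.
  by field; rewrite !gt_eqF.
have m0 : 0 < n%:R * q by rewrite mE divr_gt0 ?exprn_gt0.
have mT := @measurable_local_average R (window x0 h) mB n _ m0.
pose mix := isMeasurableFun.Build _ _ _ _ _ mT.
(* The estimator depends on the design law through [q] but not on [f], so it serves the whole
   class. *)
pose T : {mfun n.-tuple (R * R) >-> R} :=
  HB.pack (local_average (window x0 h) (n%:R * q) : n.-tuple (R * R) -> R) mix.
pose v := 3 `^ p * (4 `^ p + 2 `^ p * (K * (2 * expR (expR 1))) + 1).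
have v0 : 0 <= v.
  by rewrite mulr_ge0 ?powR_ge0// addr_ge0// addr_ge0 ?powR_ge0// !mulr_ge0 ?powR_ge0 ?expR_ge0 ?(ltW K0).
have -> : v `^ p^-1 * omega h = (v * omega h `^ p) `^ p^-1.
  by rewrite powRM ?powR_ge0// -powRrM divff ?gt_eqF// powRr1// ltW.
rewrite -poweR_EFin; apply: gt0_ler_poweR.
- by rewrite invr_ge0 ltW.
- rewrite in_itv/= leey andbT; apply: le_ereal_inf_tmp => _ [T' _ <-].
  apply: (@le_trans _ _ (pointwise_risk PX sigma p x0 (0%R : {mfun mR >-> R}) T')).
    exact: integral_ge0.
  apply: ereal_sup_ubound; exists (0%R : {mfun mR >-> R}) => //.
  split; first exact: (F_class_window s omega_pos (c := 0)).
  by move=> x _; rewrite /= normr0.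
- by rewrite in_itv/= leey lee_fin mulr_ge0 ?powR_ge0.
apply: (le_trans (ereal_inf_lbound (_ : [set _ | _ in _] _))); first by exists T.
apply: ge_ereal_sup => _ [f [fF fU] <-].
have B01 x : window x0 h x -> 0 <= x <= 1 by case.
have osc := F_class_oscillation s01 omega_pos x01 h0 fF.
have := @local_average_risk R PX sigma sigma0 (window x0 h) mB q PB n f x0 p
  (4 * omega h) alpha (omega h) K T p0 _ alpha0 r0 u1 nq K0 KP (fU x0 x01)
  (fun x xB => fU x (B01 x xB)) osc (fun=> erefl).
move=> /(_ (mulr_ge0 (ler0n _ _) (ltW r0)))/le_trans; apply.
rewrite lee_fin /v -mulrA ler_wpM2l ?powR_ge0//.
rewrite (mulrDl (4 `^ p + _)) (mulrDl (4 `^ p)) (mul1r (omega h `^ p)).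
rewrite (powRM p (ler0n R 4) (ltW r0)) (powRM p (ler0n R 2) (ltW r0)).
rewrite -mE in tail; apply: lerD; last exact: tail.
by rewrite lerD2l mulrAC.
Qed.

End minimax.

Theorem theorem2 (R : realType) (p s : R) (hp : 0 < p) (hs : 0 < s <= 1) :
  exists c C : R, [/\ 0 < c, 0 < C &
  forall omega nu rho : R -> R, RV s omega -> GammaV rho nu ->
  exists2 ell : R -> R, slowly_varying ell &
  forall (sigma x0 gamma : R) (PX : probability (measurableTypeR R) R)
         (mu : R -> R) (h alpha : nat -> R),
    0 < sigma -> 0 <= x0 <= 1 -> 0 < gamma ->
    has_density PX mu -> PX [set x | 0 <= x <= 1] = 1%E ->
    (\forall x \near x0^', mu x = nu `|x - x0|) ->
    (\forall n \near \oo, smallest_bandwidth omega nu sigma n (h n)) ->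
    (forall n, 0 < alpha n) ->
    alpha =O_\oo (fun n => omega (h n) `^ (- gamma)) ->
    (\forall n \near \oo, omega (h n) <= alpha n) ->
    let risk n := minimax_risk PX sigma p x0 n
                    (Sigma_class s (h n) (alpha n) x0 omega) in
    same_order c C risk (fun n => ell n%:R^-1) /\
    same_order c C risk (fun n => omega (h n))].
Proof.
have [K K0 KP] := powR_le_expR hp.
pose c0 : R := (1 / (4 * expR (expR 1))) `^ p^-1 / 2.
pose C0 : R := (3 `^ p * (4 `^ p + 2 `^ p * (K * (2 * expR (expR 1))) + 1)) `^ p^-1.
have c00 : 0 < c0.
  by rewrite divr_gt0// powR_gt0// divr_gt0// mulr_gt0// expR_gt0.
have C00 : 0 < C0.
  rewrite powR_gt0// mulr_gt0 ?powR_gt0// ltr_wpDl// addr_ge0 ?powR_ge0//.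
  by rewrite !mulr_ge0 ?powR_ge0 ?expR_ge0 ?(ltW K0).
(* [c0] and [C0] involve [p] only; the factor 2 is lost between [omega (h n)] and [rate]. *)
exists (c0 / 2), (2 * C0); split; [by rewrite divr_gt0|by rewrite mulr_gt0|].
move=> omega nu rho omegaRV nuGV.
have [nu_pos nu_nd] : pos_continuous nu /\ forall a b : R, 0 < a -> a <= b -> nu a <= nu b.
  by case: nuGV.
have omega_pos (t : R) : 0 < t -> 0 < omega t by have [op _] := omegaRV; move=> /op[].
exists (rate omega nu); first apply (rate_slowly_varying hs omegaRV nuGV).
move=> sigma x0 gamma PX mu h alpha sigma0 x01 gamma0 PXmu PX1 mu_nu hh alpha0 alphaO ralpha risk.
have h_lt := smallest_bandwidth_cvg0 hs omegaRV nuGV sigma0 hh.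
have rate_h := rate_bandwidth hs omegaRV nuGV sigma0 hh.
have [d d0 dP] : exists2 d : R, 0 < d &
    forall x, x != x0 -> `|x - x0| < d -> mu x = nu `|x - x0|.
  move: mu_nu => [d /= d0 dP]; exists d => // x xx0 xd; apply: dP => //=.
  by rewrite distrC.
have [A [A0 alphaA]] : exists A, 0 < A /\
    \forall n \near \oo, alpha n <= A * omega (h n) `^ (- gamma).
  move/eqO_exP: alphaO => [A A0 AP]; exists A; split => //.
  by apply: filterS AP => n; rewrite (gtr0_norm (alpha0 n)) (ger0_norm (powR_ge0 _ _)).
have kappa0 : 0 < 1 / 2 - expR (- 1) :> R by rewrite subr_gt0 expRN1_lt.
have A20 : 0 < 2 * A by rewrite mulr_gt0.
have [d2 d20 tail] := expR_beats_powR hp gamma0 A20 kappa0 sigma0.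
have s0 : 0 < s by case/andP: hs.
(* Values of [omega] below [sigma] give [u1], and values below [d2] give the tail bound. *)
have dd0 : 0 < Num.min sigma d2 by rewrite lt_min sigma0.
have [d3 d30 small] := RV_cvg0 s0 omegaRV dd0.
have bounds : \forall n \near \oo,
    ((c0 * omega (h n))%:E <= risk n)%E /\ (risk n <= (C0 * omega (h n))%:E)%E.
  near=> n.
  have n0 : (0 < n)%N by near: n; exists 1%N.
  have n0' : 0 < n%:R :> R by rewrite ltr0n.
  have [hn0 hn _] : smallest_bandwidth omega nu sigma n (h n) by near: n.
  have hnd : h n < d by near: n; exact: h_lt.
  have hnd3 : h n < d3 by near: n; exact: h_lt.
  have := small _ hn0 hnd3; rewrite lt_min => /andP[rs rd2].
  have r0 := omega_pos _ hn0.
  have PB := has_density_window nu_pos nu_nd PXmu PX1 dP hn0 hnd.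
  have info := (bandwidth_eqE omegaRV nuGV sigma0 n0 hn0).1 hn.
  (* The bandwidth equation in the form of a balance of squared bias and variance. *)
  have nq : n%:R * (2 * mass nu (h n)) * (omega (h n) ^+ 2 / sigma ^+ 2) = 1.
    have -> : n%:R * (2 * mass nu (h n)) * (omega (h n) ^+ 2 / sigma ^+ 2) =
        information omega nu (h n) * (n%:R / sigma ^+ 2).
      by rewrite /information; ring.
    by rewrite info; field; rewrite !gt_eqF.
  have u1 : omega (h n) ^+ 2 / sigma ^+ 2 <= 1.
    rewrite ler_pdivrMr ?exprn_gt0// mul1r lerXn2r ?nnegrE ?(ltW r0) ?(ltW sigma0)//.
    exact: ltW.
  split.
    apply: (minimax_risk_ge s omega_pos sigma0 hp x01 hn0 PB nq u1).
    by near: n.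
  apply: (minimax_risk_le hs omega_pos sigma0 hp x01 hn0 PB nq u1 (ltW (alpha0 n)) K0 KP).
  apply: le_trans (tail _ r0 rd2); rewrite ler_wpM2r ?expR_ge0//.
  rewrite ge0_ler_powR ?nnegrE ?(ltW hp)//.
  - by rewrite mulr_ge0// ltW.
  - by rewrite mulr_ge0 ?powR_ge0// ltW.
  by rewrite -mulrA ler_pM2l//; near: n.
split; near=> n.
  have [lo up] : ((c0 * omega (h n))%:E <= risk n)%E /\ (risk n <= (C0 * omega (h n))%:E)%E.
    by near: n.
  have /andP[r1 r2] : rate omega nu n%:R^-1 / 2 <= omega (h n) <= 2 * rate omega nu n%:R^-1.
    by near: n.
  split; [apply: le_trans lo|apply: (le_trans up)]; rewrite lee_fin.
    by rewrite -mulrA (mulrC _^-1) ler_pM2l.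
  by rewrite -(mulrA 2) mulrCA ler_pM2l.
have [lo up] : ((c0 * omega (h n))%:E <= risk n)%E /\ (risk n <= (C0 * omega (h n))%:E)%E.
  by near: n.
have [hn0 _ _] : smallest_bandwidth omega nu sigma n (h n) by near: n.
have r0 := omega_pos _ hn0.
split; [apply: le_trans lo|apply: (le_trans up)]; rewrite lee_fin ler_wpM2r ?(ltW r0)//.
  by rewrite ler_pdivrMr// ler_peMr ?ler1n// ltW.
by rewrite ler_peMl ?ler1n// ltW.
Unshelve. all: by end_near. Qed.
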